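(* Let $\alpha,\beta\in[0,1]$ and let $\{H^{(N)}\}_{N=1}^\infty$ be a sequence of deterministic $N$-by-$N$ complex Hadamard matrices. Let $X$ and $Y$ be independent random variables such that $X=1$ with probability $\alpha$ and $X=0$ with probability $1-\alpha$, and $Y=1$ with probability $\beta$ and $Y=0$ with probability $1-\beta$. Let $\{(X(i),Y(i))\}_{i=1}^\infty$ be an i.i.d. family of copies of the pair $(X,Y)$, and for each $N$ let $X^{(N)}$ (resp. $Y^{(N)}$) be the $N$-by-$N$ diagonal random matrix with diagonal entries $X(1),\dots,X(N)$ (resp. $Y(1),\dots,Y(N)$). Then the expected empirical distribution function of $$\frac1N X^{(N)}H^{(N)}Y^{(N)}H^{(N)*}X^{(N)}$$ converges in moments to the distribution with density $$(1-\min(\alpha,\beta))\,\delta_0(x)+\max(\alpha+\beta-1,0)\,\delta_1(x)+\frac{\sqrt{(\lambda_+-x)(x-\lambda_-)}}{2\pi x(1-x)}\,I_{[\lambda_-,\lambda_+]}(x),$$ where $I_{[\lambda_-,\lambda_+]}$ denotes the indicator function of $[\lambda_-,\lambda_+]$ and $$\lambda_\pm=\alpha+\beta-2\alpha\beta\pm\sqrt{4\alpha\beta(1-\alpha)(1-\beta)}.$$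
   Context: An $N$-by-$N$ complex matrix $H$ is a complex Hadamard matrix if $H/\sqrt N$ is unitary and $|H(i,j)|=1$ for all $i,j$. The empirical distribution function of a Hermitian $N$-by-$N$ matrix $M$ with eigenvalues $\lambda_1(M),\dots,\lambda_N(M)$ is $F_M(x)=\frac1N\#\{i:\lambda_i(M)\le x\}$; the expected empirical distribution function of a random Hermitian matrix $M$ is $\mathbf{E}F_M$, whose $k$-th moment is $\frac1N\mathbf{E}\,\mathrm{tr}\,M^k$ ($\mathrm{tr}$ the unnormalized trace). Convergence in moments means that for every integer $k\ge 0$ the $k$-th moments converge to the $k$-th moment of the limiting distribution. $\delta_0$ and $\delta_1$ denote unit point masses at $0$ and $1$, so the displayed ''density'' describes a measure with atoms at $0$ and $1$ of the stated weights plus an absolutely continuous part. *)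

(* Defs.v *)
(* MathComp-Analysis; complex numbers are R[i] (mathcomp-real-closed) over an
   arbitrary R : realType. *)
From HB Require Import structures.
From mathcomp Require Import all_boot all_order all_algebra finmap.
From mathcomp Require Import complex.
From mathcomp Require Import all_classical all_reals all_analysis.

Set Implicit Arguments.
Unset Strict Implicit.
Unset Printing Implicit Defensive.

Import Order.TTheory GRing.Theory Num.Theory.
Import numFieldNormedType.Exports.

Local Open Scope classical_set_scope.
Local Open Scope ring_scope.
Local Open Scope complex_scope.
Local Open Scope sesquilinear_scope.

Definition complex_hadamard (R : realType) (N : nat) (H : 'M[R[i]]_N) : Prop :=
  ((Num.sqrt N%:R : R)%:C)^-1 *: H \is unitarymx /\
  forall i j, `|H i j| = 1.

Definition indep_rv d d1 d2 (T : measurableType d) (T1 : measurableType d1)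
    (T2 : measurableType d2) (R : realType) (P : probability T R)
    (X : T -> T1) (Y : T -> T2) : Prop :=
  forall A B, measurable A -> measurable B ->
    P (X @^-1` A `&` Y @^-1` B) = (P (X @^-1` A) * P (Y @^-1` B))%E.

Definition mutually_indep d d' (T : measurableType d) (T' : measurableType d')
    (R : realType) (P : probability T R) (Z : nat -> T -> T') : Prop :=
  forall (J : {fset nat}) (A : nat -> set T'), (forall i, measurable (A i)) ->
    P (\bigcap_(i in [set` J]) (Z i @^-1` A i)) =
    (\prod_(i <- J) P (Z i @^-1` A i))%E.

Definition same_law d d' (T : measurableType d) (T' : measurableType d')
    (R : realType) (P : probability T R) (Z Z' : T -> T') : Prop :=
  forall A, measurable A -> P (Z @^-1` A) = P (Z' @^-1` A).

Definition iid_copies d d' (T : measurableType d) (T' : measurableType d')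
    (R : realType) (P : probability T R) (Z0 : T -> T') (Z : nat -> T -> T') :=
  mutually_indep P Z /\ forall i, same_law P (Z i) Z0.

(* Sequences are indexed from 0: x i is the (i+1)-th diagonal entry. *)
Definition diag_of (R : realType) (N : nat) (x : nat -> R) : 'M[R[i]]_N :=
  diag_mx (\row_(i < N) (x i)%:C).

Definition XHYHX (R : realType) (N : nat) (H : 'M[R[i]]_N) (x y : nat -> R) :
    'M[R[i]]_N :=
  (N%:R)^-1 *: (diag_of N x *m H *m diag_of N y *m H ^t* *m diag_of N x).

(* For a Hermitian M, [spectral_diag M] lists the eigenvalues of M with
   multiplicity; they are real, and a <= b in R[i] is the order of R when a and
   b are real. *)
Definition edf (R : realType) (N : nat) (M : 'M[R[i]]_N) (x : R) : R :=
  #|[set i : 'I_N | spectral_diag M 0 i <= x%:C]%SET|%:R / N%:R.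

Definition expected_edf d (T : measurableType d) (R : realType)
    (P : probability T R) (N : nat) (M : T -> 'M[R[i]]_N) (x : R) : \bar R :=
  ('E_P[fun w => edf (M w) x])%E.

(* [mu] is the (unique) probability measure with distribution function F. *)
Definition has_df (R : realType) (mu : probability (measurableTypeR R) R)
    (F : R -> \bar R) : Prop :=
  forall x : R, mu [set` `]-oo, x]] = F x.

(* [mu] is the distribution with generalized density
   w0 * delta_0 + w1 * delta_1 + f. *)
Definition has_density01 (R : realType)
    (mu : probability (measurableTypeR R) R) (w0 w1 : R) (f : R -> R) : Prop :=
  forall A : set (measurableTypeR R), measurable A ->
    mu A = (w0%:E * \d_(0 : R)%R A + w1%:E * \d_(1 : R)%R A
            + \int[lebesgue_measure]_(x in A) (f x)%:E)%E.

Definition has_moments (R : realType)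
    (mu : probability (measurableTypeR R) R) : Prop :=
  forall k : nat, mu.-integrable setT (fun x : R => (x ^+ k)%:E).

Definition moment (R : realType) (mu : probability (measurableTypeR R) R)
    (k : nat) : R := (\int[mu]_x (x ^+ k : R))%R.

Definition cvg_in_moments (R : realType)
    (nu : nat -> probability (measurableTypeR R) R)
    (mu : probability (measurableTypeR R) R) : Prop :=
  [/\ forall n, has_moments (nu n), has_moments mu &
      forall k : nat, moment (nu n) k @[n --> \oo] --> moment mu k].

Definition lambda_plus (R : realType) (a b : R) : R :=
  a + b - 2 * a * b + Num.sqrt (4 * a * b * (1 - a) * (1 - b)).

Definition lambda_minus (R : realType) (a b : R) : R :=
  a + b - 2 * a * b - Num.sqrt (4 * a * b * (1 - a) * (1 - b)).

Definition limit_density (R : realType) (a b x : R) : R :=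
  Num.sqrt ((lambda_plus a b - x) * (x - lambda_minus a b))
    / (2 * pi * x * (1 - x))
  * \1_(`[lambda_minus a b, lambda_plus a b]%classic) x.

(* Main.v *)
(* Write p = X and q = H Y H^* / N (two projections), a = p - alpha and
   b = q - beta.

   Asymptotic freeness.  Expanding tr (ab)^k over row indices i_1 .. i_k and
   column indices j_1 .. j_k, every term has modulus at most N^-k since the
   entries of H are unimodular, and its mean vanishes unless each row index and
   each column index occurs at least twice, which leaves O(N^k) terms.  Hence
   E (1/N) tr (ab)^k = O(1/N) for all k >= 1.

   Algebra.  The element y = 1 - (p - q)^2 commutes with p and q, and
   pqp = p y.  With K = pq - qp = ab - ba one has y - y^2 = - K^2, and
   (y - c) (ab)^(n+1) = (ab)^(n+2) + v (ab)^n for c = alpha + beta - 2 alpha beta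
   and v = alpha (1 - alpha) beta (1 - beta).  So P_n(y) K = (ab)^(n+1) - (ba)^(n+1)
   for the Chebyshev polynomials P_n of the semicircle law with mean c and
   variance v, and up to O(1/N) the mean spectral distribution of pqp integrates
   (x - x^2) P_n(x) to v if n = 0 and to 0 otherwise.

   Limit law.  Its density times x - x^2 is v times that semicircle density, so
   it satisfies the same relations exactly; its mass and mean are computed by
   splitting 1 / (x (1 - x)) into partial fractions.  Since 1, x and the
   (x - x^2) P_n span all polynomials, the moments converge. *)

Require Import Defs.
From HB Require Import structures.
From mathcomp Require Import all_boot all_order all_algebra finmap.
From mathcomp Require Import complex ring lra.
From mathcomp Require Import all_classical all_reals all_analysis.
From mathcomp Require Import measurable_realfun interval_inference.

Set Implicit Arguments.
Unset Strict Implicit.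
Unset Printing Implicit Defensive.

Import Order.TTheory GRing.Theory Num.Theory.
Import numFieldNormedType.Exports.

Local Open Scope ring_scope.
Local Open Scope sesquilinear_scope.

(** * Two projections *)

(* Monic orthogonal polynomials of the semicircle law with mean c and variance v. *)
Fixpoint cheb (F : comNzRingType) (c v : F) (n : nat) {struct n} : {poly F} :=
  match n with
  | 0 => 1
  | 1 => 'X - c%:P
  | (m.+1 as n').+1 => ('X - c%:P) * cheb c v n' - v *: cheb c v m
  end.

Lemma chebSS (F : comNzRingType) (c v : F) n :
  cheb c v n.+2 = ('X - c%:P) * cheb c v n.+1 - v *: cheb c v n.
Proof. by []. Qed.

Lemma mx_entD (F : nzRingType) m n (M N : 'M[F]_(m, n)) i j :
  (M + N) i j = M i j + N i j.
Proof. by rewrite mxE. Qed.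

Lemma mx_entN (F : nzRingType) m n (M : 'M[F]_(m, n)) i j : (- M) i j = - M i j.
Proof. by rewrite mxE. Qed.

Lemma mx_entZ (F : nzRingType) m n (k : F) (M : 'M[F]_(m, n)) i j :
  (k *: M) i j = k * M i j.
Proof. by rewrite mxE. Qed.

(** Brings a matrix expression to a sum of left-nested noncommutative monomials, where [idem_mulr]
    can contract a repeated projection. [compare_entries] then treats the entry of each monomial as
    an atom of the scalar ring. *)
Ltac distribute_products :=
  rewrite ?expr2 !(mulrDl, mulrDr, mulNr, mulrN, opprK, opprD, mulr1, mul1r,
    scalerDr, scalerN) -?scalerAl -?scalerAr ?(mulr1, mul1r) ?mulrA.

Ltac compare_entries :=
  let i := fresh "i" in let j := fresh "j" in
  apply/matrixP => i j; rewrite ?(mx_entD, mx_entN, mx_entZ); ring.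

Lemma idem_mulr (F : comNzRingType) n (e x : 'M[F]_n.+1) :
  e * e = e -> x * e * e = x * e.
Proof. by move=> ee; rewrite -mulrA ee. Qed.

(** With Z = y - c and X = ab or ba this becomes the three-term recurrence that defines [cheb]. *)
Lemma mul_exprS_step (F : comNzRingType) n (Z X : 'M[F]_n.+1) (v : F) m :
  Z * X = X * X + v%:A -> Z * X ^+ m.+1 = X ^+ m.+2 + v *: X ^+ m.
Proof. by move=> ZX; rewrite exprS mulrA ZX mulrDl mulr_algl -mulrA -!exprS. Qed.

Section TwoProjections.
Variables (F : comNzRingType) (k : nat) (p q : 'M[F]_k.+1) (al be : F).
Hypotheses (pp : p * p = p) (qq : q * q = q).

Let a := p - al%:A.
Let b := q - be%:A.
Let s := 1 - 2 * al.
Let t := 1 - 2 * be.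
Let u := al * (1 - al).
Let w := be * (1 - be).
Let c := al + be - 2 * al * be.
Let v := u * w.
Let y := 1 - (p - q) ^+ 2.
Let K := p * q - q * p.

(** The possible eigenvalues 1 - x and -x of e - x have sum 1 - 2x and product -x(1 - x). *)
Lemma centered_idem_sq (e : 'M[F]_k.+1) (x : F) : e * e = e ->
  (e - x%:A) * (e - x%:A) = (1 - 2 * x) *: (e - x%:A) + (x * (1 - x))%:A.
Proof. by move=> ee; distribute_products; rewrite ee; compare_entries. Qed.

Let aa : a * a = s *: a + u%:A. Proof. exact: centered_idem_sq. Qed.
Let bb : b * b = t *: b + w%:A. Proof. exact: centered_idem_sq. Qed.

(** Up to the scalar u, the matrix a - s is an inverse of a; [center_ab] collapses its second term
    from the middle by this and by [bw]. *)
Let au : (a - s%:A) * a = u%:A.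
Proof. by rewrite mulrBl mulr_algl aa addrAC subrr add0r. Qed.
Let bw : (b - t%:A) * b = w%:A.
Proof. by rewrite mulrBl mulr_algl bb addrAC subrr add0r. Qed.

Lemma proj_mul_center : p * y = p * q * p.
Proof.
rewrite /y; distribute_products; rewrite !(pp, qq, idem_mulr)//.
compare_entries.
Qed.

Lemma center_mul_proj : y * p = p * q * p.
Proof.
rewrite /y; distribute_products; rewrite !(pp, qq, idem_mulr)//.
compare_entries.
Qed.

Lemma center_sub_sq : y - y ^+ 2 = - K ^+ 2.
Proof.
rewrite /y /K; distribute_products; rewrite !(pp, qq, idem_mulr)//.
compare_entries.
Qed.

Lemma center_comm_K : GRing.comm y K.
Proof.
rewrite /GRing.comm /y /K; distribute_products; rewrite !(pp, qq, idem_mulr)//.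
compare_entries.
Qed.

(** Both sides equal pq - pqp. The commutator thus exchanges p with 1 - p, so under the trace p can
    be traded for 1/2 next to K^2. *)
Lemma proj_mul_K : p * K = K * (1 - p).
Proof.
rewrite /K; distribute_products; rewrite !(pp, qq, idem_mulr)//.
compare_entries.
Qed.

(** The decomposition y - c = ab + (b - t)(a - s) is a matrix form of z + v/z: multiplied by ab, the
    second summand reduces to uw = v. *)
Lemma center_ab : (y - c%:A) * (a * b) = a * b * (a * b) + v%:A.
Proof.
have -> : y - c%:A = a * b + (b - t%:A) * (a - s%:A).
  rewrite /y /a /b /c /t /s; distribute_products.
  by rewrite pp qq; compare_entries.
rewrite mulrDl; congr (_ + _).
have -> : (b - t%:A) * (a - s%:A) * (a * b) =
  (b - t%:A) * ((a - s%:A) * a) * b by rewrite !mulrA.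
by rewrite au mulr_algr -scalerAl bw scalerA.
Qed.

Lemma center_ba : (y - c%:A) * (b * a) = b * a * (b * a) + v%:A.
Proof.
have -> : y - c%:A = b * a + (a - s%:A) * (b - t%:A).
  rewrite /y /a /b /c /t /s; distribute_products.
  by rewrite pp qq; compare_entries.
rewrite mulrDl; congr (_ + _).
have -> : (a - s%:A) * (b - t%:A) * (b * a) =
  (a - s%:A) * ((b - t%:A) * b) * a by rewrite !mulrA.
by rewrite bw mulr_algr -scalerAl au scalerA mulrC.
Qed.

Lemma K_centered : K = a * b - b * a.
Proof. by rewrite /K /a /b; distribute_products; compare_entries. Qed.

(** Powers of ab and of ba obey the same recurrence as [cheb]. The scalars v produced in degree one
    cancel in the difference, so the identity is exact. Two consecutive degrees are carried through
    the induction. *)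
Lemma cheb_center_K n :
  horner_mx y (cheb c v n) * K = (a * b) ^+ n.+1 - (b * a) ^+ n.+1.
Proof.
suff [] : horner_mx y (cheb c v n) * K = (a * b) ^+ n.+1 - (b * a) ^+ n.+1 /\
   horner_mx y (cheb c v n.+1) * K = (a * b) ^+ n.+2 - (b * a) ^+ n.+2 by [].
elim: n => [|n [IH1 IH2]]; split=> //.
- by rewrite rmorph1 mul1r K_centered !expr1.
- rewrite /= rmorphB /= horner_mx_X horner_mx_C -[c%:M]scalemx1 K_centered mulrBr.
  by rewrite center_ab center_ba !expr2 opprD addrACA subrr addr0.
- rewrite chebSS rmorphB rmorphM /= linearZ /= rmorphB /= horner_mx_X horner_mx_C.
  rewrite -[c%:M]scalemx1 mulrBl -mulrA IH2 -scalerAl IH1 mulrBr.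
  rewrite (mul_exprS_step _ center_ab) (mul_exprS_step _ center_ba).
  by rewrite scalerBr opprD addrACA addrK.
Qed.
End TwoProjections.

Lemma mxtrace_mulrC (F : comNzRingType) n (X Y : 'M[F]_n.+1) :
  \tr (X * Y) = \tr (Y * X).
Proof. exact: mxtrace_mulC. Qed.

Lemma mxtrace_mul_centered (F : comNzRingType) n (p q : 'M[F]_n.+1) (al be : F) :
  \tr (p * q) = \tr ((p - al%:A) * (q - be%:A)) + be * \tr (p - al%:A)
    + al * \tr (q - be%:A) + al * be * n.+1%:R.
Proof.
rewrite mulrBl !mulrBr mulr_algr !mulr_algl.
by rewrite !raddfB /= !mxtraceZ !mxtrace1; ring.
Qed.

Lemma mulr_exprC (F : pzRingType) (x z : F) m : x * (z * x) ^+ m = (x * z) ^+ m * x.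
Proof.
by elim: m => [|m IH]; rewrite ?mulr1 ?mul1r// exprS -mulrA IH !mulrA -exprS.
Qed.

Lemma mxtrace_expr_mulC (F : comNzRingType) n (x z : 'M[F]_n.+1) m :
  \tr ((x * z) ^+ m) = \tr ((z * x) ^+ m).
Proof.
case: m => [|m]; first by rewrite !expr0.
by rewrite exprSr mulrA mxtrace_mulrC mulrA mulr_exprC -mulrA -exprSr.
Qed.

(** * Reduction of traces of words in two centred projections *)

Section CenteredWords.
Variables (F : comNzRingType) (k : nat) (a b : 'M[F]_k.+1) (s t u w : F).
Hypotheses (aa : a * a = s *: a + u%:A) (bb : b * b = t *: b + w%:A).

(** Cyclicity brings the first and last b together, and the quadratic relation for b shortens the
    word. *)
Lemma mxtrace_oddS m :
  \tr (b * (a * b) ^+ m.+1) = t * \tr ((a * b) ^+ m.+1) + w * \tr (a * (b * a) ^+ m).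
Proof.
rewrite mxtrace_mulrC exprSr mulrA -mulrA bb.
by rewrite mulrDr -scalerAr mulr_algr raddfD /= !mxtraceZ mulr_exprC -(mulrA _ a b) -exprSr.
Qed.

(** The word contains aa; replacing it by sa + u leaves an alternating word and one with bb, which
    is reduced in turn. *)
Lemma mxtrace_foldS m :
  \tr (b * a * (a * b) ^+ m.+1) = s * \tr (b * (a * b) ^+ m.+1)
   + u * (t * \tr (b * (a * b) ^+ m) + w * \tr ((a * b) ^+ m)).
Proof.
rewrite {1}exprS !mulrA -(mulrA b a a) aa mulrDr !mulrDl.
rewrite -!scalerAr -!scalerAl mulr1 bb !mulrDl -!scalerAl mul1r !scalerDr.
rewrite !raddfD /= !mxtraceZ.
by rewrite exprS mulrDr !mulrA.
Qed.
End CenteredWords.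

Section CompressionTrace.
Variables (F : comNzRingType) (k : nat) (p q : 'M[F]_k.+1) (al be : F).
Hypotheses (pp : p * p = p) (qq : q * q = q).

Let a := p - al%:A.
Let b := q - be%:A.
Let s := 1 - 2 * al.
Let t := 1 - 2 * be.
Let u := al * (1 - al).
Let w := be * (1 - be).
Let y := 1 - (p - q) ^+ 2.

(** Holds because pqp = py with y commuting with the idempotent p. The factor pqp in front takes
    care of the constant term of f, whose value is a multiple of 1 and not of p. *)
Lemma horner_compression (f : {poly F}) :
  p * q * p * horner_mx (p * q * p) f = p * y * horner_mx y f.
Proof.
have py : p * y = p * q * p := proj_mul_center pp qq.
have yp : y * p = p * q * p := center_mul_proj pp qq; clearbody y.
elim/poly_ind: f => [|f x IH]; first by rewrite !rmorph0 !mulr0.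
rewrite !rmorphD !rmorphM /= !horner_mx_X !horner_mx_C !mulrDr !mulrA IH.
congr (_ + _); last by rewrite py.
have fp : horner_mx y f * p = p * horner_mx y f.
  by apply: comm_horner_mx; rewrite /comm_mx -!mulmxE in yp py *; rewrite yp py.
have yyp : p * y * p = p * y by rewrite py idem_mulr.
rewrite -(mulrA _ p q) -(mulrA _ (p * q) p) -py mulrA.
by rewrite -(mulrA _ (horner_mx y f)) fp mulrA yyp.
Qed.

Lemma horner_compression_edge (f : {poly F}) :
  horner_mx (p * q * p) (('X - 'X^2) * f) = p * (y - y ^+ 2) * horner_mx y f.
Proof.
have -> : ('X - 'X^2) * f = 'X * ((1 - 'X) * f) by ring.
rewrite rmorphM /= horner_mx_X horner_compression rmorphM rmorphB /= rmorph1.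
by rewrite horner_mx_X !mulrA -[in LHS](mulrA p) mulrBr mulr1 expr2.
Qed.

(** The left side is the trace of -2 p K^2 P(y), that is of -K P(y) K. Here P(y) K is a difference
    of words by [cheb_center_K]; the products of ab with ba are then folded by [mxtrace_foldS]. The
    factor 2 avoids dividing in a general ring. *)
Lemma trace_compression_cheb n :
  2 * \tr (horner_mx (p * q * p)
             (('X - 'X^2) * cheb (al + be - 2 * al * be) (u * w) n)) =
  2 * (u * w) * \tr ((a * b) ^+ n) - 2 * \tr ((a * b) ^+ n.+2)
  + (s * \tr (b * (a * b) ^+ n.+1) + u * t * \tr (b * (a * b) ^+ n))
  + (t * \tr (a * (b * a) ^+ n.+1) + w * s * \tr (a * (b * a) ^+ n)).
Proof.
rewrite horner_compression_edge (center_sub_sq pp qq).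
set P := cheb _ _ _; set K := p * q - q * p.
have yK : horner_mx y P * K = K * horner_mx y P.
  exact: (comm_horner_mx _ (center_comm_K pp qq)).
have pK : p * K = K * (1 - p) := proj_mul_K q pp.
have half : 2 * \tr (p * - K ^+ 2 * horner_mx y P) = - \tr (K * (horner_mx y P * K)).
  (* Moving one K past p and then around the trace turns p into 1 - p; adding the two forms
     eliminates p. *)
  have E1 : \tr (p * - K ^+ 2 * horner_mx y P) =
            \tr ((1 - p) * - K ^+ 2 * horner_mx y P).
    rewrite !mulrN !mulNr !raddfN /= expr2 !mulrA pK -!mulrA mxtrace_mulrC.
    by rewrite -!mulrA yK.
  rewrite mulr_natl mulr2n {2}E1 -raddfD /= -!mulrDl addrC subrK mul1r mulNr raddfN /=.
  by rewrite yK mulrA expr2.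
rewrite {}half (cheb_center_K al be pp qq) /K (K_centered p q al be) -/a -/b.
have aa : a * a = s *: a + u%:A := centered_idem_sq al pp.
have bb : b * b = t *: b + w%:A := centered_idem_sq be qq.
have F1 := mxtrace_foldS aa bb n; have F2 := mxtrace_foldS bb aa n.
have T m := mxtrace_expr_mulC b a m.
clear K yK pK aa bb.
clearbody a b s t u w.
rewrite mulrBr !mulrBl -!exprS !raddfB /= F1 F2 !T.
ring.
Qed.
End CompressionTrace.

(** * Asymptotic freeness *)

(** Weights over an arbitrary ring serve both as probabilities in R and as coefficients of traces in
    R[i]. *)
Definition bern (C : comPzRingType) (p : C) (b : bool) : C := if b then p else 1 - p.

Definition bern_wt (C : comPzRingType) (p : C) n (x : {ffun 'I_n -> bool}) : C :=
  \prod_i bern p (x i).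

(** Independence of the coordinates, as distributivity of products over sums. *)
Lemma bern_wt_prod (C : comPzRingType) (p : C) n (G : 'I_n -> bool -> C) :
  \sum_(x : {ffun 'I_n -> bool}) bern_wt p x * \prod_i G i (x i) =
  \prod_i (p * G i true + (1 - p) * G i false).
Proof.
under [LHS]eq_bigr do rewrite /bern_wt -big_split /=.
rewrite -(bigA_distr_bigA (fun i b => bern p b * G i b)).
by apply: eq_bigr => i _; rewrite big_bool.
Qed.

Lemma bern_wt_sum (C : comPzRingType) (p : C) n :
  \sum_(x : {ffun 'I_n -> bool}) bern_wt p x = 1.
Proof.
transitivity (\prod_(i < n) (p * 1 + (1 - p) * 1)); last first.
  by apply: big1 => i _; rewrite !mulr1 addrC subrK.
rewrite -(bern_wt_prod p (fun _ _ => 1)).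
by apply: eq_bigr => x _; rewrite big1 ?mulr1.
Qed.

Lemma bern_wt_centered (C : comNzRingType) (p : C) n (i : 'I_n) :
  \sum_(x : {ffun 'I_n -> bool}) bern_wt p x * ((x i)%:R - p) = 0.
Proof.
have E (x : {ffun 'I_n -> bool}) : (x i)%:R - p =
    \prod_(j < n) (if j == i then (x j)%:R - p else 1) :> C.
  by rewrite (bigD1 i)//= eqxx big1 ?mulr1// => j /negPf ->.
under eq_bigr do rewrite E.
rewrite (bern_wt_prod p (fun j b => if j == i then b%:R - p else 1)).
rewrite (bigD1 i)//= eqxx (_ : _ + _ * (0 - p) = 0) ?mul0r//.
by rewrite sub0r mulrN [p * _]mulrC subrr.
Qed.

Definition no_singleton_fiber k (I : finType) (g : 'I_k -> I) :=
  [forall i, #|[set l | g l == i]| != 1%N].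

Section BernoulliMoments.
Variables (C : numDomainType) (p : C).
Hypothesis p01 : 0 <= p <= 1.

(** Grouping equal indices factors the mean into centred moments of single Bernoulli variables. Each
    has modulus at most p + (1 - p) = 1, and the first one is 0, which kills any word with an index
    of multiplicity one. *)
Lemma bern_wt_centered_prod n k (g : 'I_k -> 'I_n) :
  `|\sum_(x : {ffun 'I_n -> bool}) bern_wt p x * \prod_l ((x (g l))%:R - p)|
  <= (no_singleton_fiber g)%:R.
Proof.
have /andP[p0 p1] := p01.
have E (x : {ffun 'I_n -> bool}) : \prod_l ((x (g l))%:R - p) =
    \prod_i ((x i)%:R - p) ^+ #|[set l | g l == i]|.
  rewrite (partition_big g xpredT)//=; apply: eq_bigr => i _.
  under eq_bigr => l /eqP -> do [].
  by rewrite prodr_const cardsE.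
under eq_bigr do rewrite E.
rewrite (bern_wt_prod p (fun i b => (b%:R - p) ^+ #|[set l | g l == i]|)).
rewrite normr_prod; case: (boolP (no_singleton_fiber g)) => [_|].
  apply: prodr_ile1 => i _; rewrite normr_ge0/=.
  apply: le_trans (ler_normD _ _) _.
  rewrite !normrM !normrX sub0r normrN !ger0_norm ?subr_ge0//.
  rewrite -[leRHS](subrKC p) lerD// ler_piMr ?subr_ge0//.
    by rewrite exprn_ile1 ?subr_ge0// lerBlDr lerDl.
  by rewrite exprn_ile1.
rewrite negb_forall => /existsP; case=> i; rewrite negbK => /eqP gi.
rewrite (bigD1 i)//= gi !expr1 sub0r mulrN [(1 - p) * p]mulrC subrr.
by rewrite normr0 mul0r.
Qed.
End BernoulliMoments.

(* The image of such a map has at most k/2 elements, so the map factors through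
   'I_(k./2). *)
Lemma card_no_singleton_fiber k n :
  (#|[set g : {ffun 'I_k -> 'I_n} | no_singleton_fiber g]| <=
     (k./2) ^ k * n ^ (k./2))%N.
Proof.
pose compose (th : {ffun 'I_(k./2) -> 'I_n} * {ffun 'I_k -> 'I_(k./2)}) :=
  [ffun l => th.1 (th.2 l)] : {ffun 'I_k -> 'I_n}.
suff sub : [set g : {ffun 'I_k -> 'I_n} | no_singleton_fiber g] \subset
    compose @: [set: _]%SET.
  apply: leq_trans (fintype.subset_leq_card sub) _; apply: leq_trans (leq_imset_card _ _) _.
  by rewrite finset.cardsT card_prod !card_ffun !card_ord mulnC.
apply/fintype.subsetP => g; rewrite inE => /forallP gS.
(* For k = 0 only the empty map exists; for k > 0 the value at [ord0] shows that the image S is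
   nonempty. *)
case: k => [|k] in compose g gS *.
  apply/imsetP; exists (ffun0 (card_ord 0), ffun0 (card_ord 0)) => //.
  by apply/ffunP => -[].
pose S := g @: [set: _]%SET.
have cS : (#|S| <= (k.+1)./2)%N.
  have kE : (k.+1 = \sum_(i in S) #|[set l | g l == i]|)%N.
    rewrite -[LHS]card_ord -finset.cardsT -sum1_card (partition_big_imset g) /=.
    apply: eq_bigr => i _; rewrite -sum1_card; apply: eq_bigl => l.
    by rewrite !inE.
  rewrite geq_half_double -muln2 [leqRHS]kE -sum_nat_const leq_sum// => i.
  case/imsetP=> l _ ->; case: ltngtP (gS (g l)) => //.
  by rewrite ltnS leqn0 cards_eq0 => /eqP/setP/(_ l); rewrite !inE eqxx.
have S0 : (0 < #|S|)%N by apply/card_gt0P; exists (g ord0); exact: imset_f.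
pose y0 := g ord0; have y0S : y0 \in S by exact: imset_f.
(* The map g is factored through the positions of its values in the enumeration of S; [y0] fills the
   positions beyond the size of S. *)
pose t := [ffun j : 'I_((k.+1)./2) => nth y0 (enum S) j].
pose h := [ffun l : 'I_k.+1 => widen_ord cS (enum_rank_in y0S (g l))].
apply/imsetP; exists (t, h) => //; apply/ffunP => l; rewrite !ffunE /=.
by rewrite -enum_val_nth enum_rankK_in ?imset_f.
Qed.

(** * Expansion and mean of words in the random projections *)

Section RandomProjections.
Variables (C : numClosedFieldType) (n : nat) (H : 'M[C]_n.+1).
Hypotheses (Hflat : forall i j, `|H i j| = 1)
  (HHt : H *m H^t* = n.+1%:R%:M).
Variables al be : C.
Hypotheses (al01 : 0 <= al <= 1) (be01 : 0 <= be <= 1).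

Definition row_proj (x : {ffun 'I_n.+1 -> bool}) : 'M[C]_n.+1 :=
  diag_mx (\row_i (x i)%:R).

Definition had_proj (y : {ffun 'I_n.+1 -> bool}) : 'M[C]_n.+1 :=
  n.+1%:R^-1 *: (H *m diag_mx (\row_j (y j)%:R) *m H^t*).

Lemma had_adjmul : H^t* *m H = n.+1%:R%:M.
Proof.
have n0 : n.+1%:R != 0 :> C by rewrite pnatr_eq0.
have /mulmx1C : (n.+1%:R^-1 *: H) *m H^t* = 1%:M.
  by rewrite -scalemxAl HHt scale_scalar_mx mulVf.
by rewrite -scalemxAr => /(congr1 ( *:%R n.+1%:R)); rewrite scalerA mulfV// scale1r scalemx1.
Qed.

Lemma row_proj_idem x : row_proj x * row_proj x = row_proj x.
Proof.
rewrite /row_proj -mulmxE mulmx_diag; congr diag_mx; apply/rowP => i.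
by rewrite !mxE; case: (x i); rewrite ?mulr1 ?mulr0.
Qed.

Lemma had_proj_idem y : had_proj y * had_proj y = had_proj y.
Proof.
have n0 : n.+1%:R != 0 :> C by rewrite pnatr_eq0.
rewrite /had_proj -mulmxE -scalemxAl -scalemxAr !mulmxA -(mulmxA _ (H^t*) H).
rewrite had_adjmul -scalemx1 -!scalemxAr mulmx1 -!scalemxAl !scalerA mulVf// mulr1.
rewrite -[_ *m _ *m diag_mx _]mulmxA mulmx_diag.
congr (_ *: (_ *m diag_mx _ *m _)); apply/rowP => i.
by rewrite !mxE; case: (y i); rewrite ?mulr1 ?mulr0.
Qed.

(** For e = (i, j) this is E_ii q_j, where q_j is the rank-one projection onto the j-th column of
    H. *)
Definition unit_block (e : 'I_n.+1 * 'I_n.+1) : 'M[C]_n.+1 :=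
  \matrix_(r, s) ((r == e.1)%:R * (n.+1%:R^-1 * (H e.1 e.2 * (H s e.2)^* ))).

(** The E_ii sum to 1, and so do the q_j because H H^* = N; centring therefore only shifts the
    coefficients. *)
Lemma row_had_expand x y :
  (row_proj x - al%:A) * (had_proj y - be%:A) =
  \sum_e (((x e.1)%:R - al) * ((y e.2)%:R - be)) *: unit_block e.
Proof.
have n0 : n.+1%:R != 0 :> C by rewrite pnatr_eq0.
have -> : row_proj x - al%:A = diag_mx (\row_i ((x i)%:R - al)).
  apply/matrixP => i j; rewrite !mxE; case: eqP => _; rewrite ?mulr1n ?mulr0n ?mulr1//.
  by rewrite mulr0 subr0.
have -> : had_proj y - be%:A =
    n.+1%:R^-1 *: (H *m diag_mx (\row_j ((y j)%:R - be)) *m H^t*).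
  have -> : diag_mx (\row_j ((y j)%:R - be)) =
      diag_mx (\row_j (y j)%:R) - be%:M :> 'M[C]_n.+1.
    apply/matrixP => i j; rewrite !mxE; case: eqP => _; rewrite ?mulr1n ?mulr0n//.
    by rewrite subr0.
  rewrite mulmxBr mulmxBl scalerBr; congr (_ - _).
  rewrite mul_mx_scalar -scalemxAl HHt !scale_scalar_mx.
  by rewrite mulrCA mulVf.
apply/matrixP => r s; rewrite -mulmxE mul_diag_mx summxE !mxE.
rewrite (eq_bigr (fun e : 'I_n.+1 * 'I_n.+1 => (((x e.1)%:R - al) * ((y e.2)%:R - be)) *
  ((r == e.1)%:R * (n.+1%:R^-1 * (H e.1 e.2 * (H s e.2)^* ))))); last first.
  by move=> e _; rewrite !mxE.
rewrite -(pair_bigA _ (fun i j => (((x i)%:R - al) * ((y j)%:R - be)) *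
  ((r == i)%:R * (n.+1%:R^-1 * (H i j * (H s j)^* )))))/=.
rewrite [RHS](bigD1 r)//= [X in _ = _ + X]big1 ?addr0; last first.
  move=> i /negPf ir; rewrite big1// => j _.
  by rewrite eq_sym ir mul0r mulr0.
rewrite mulr_sumr mulr_sumr; apply: eq_bigr => j _.
rewrite mul_mx_diag !mxE eqxx mul1r.
ring.
Qed.

(** A block has a single nonzero row, with entries of modulus 1/N. Each inner summation of the
    product thus has at most one nonzero term, and the moduli multiply. *)
Lemma unit_block_prod k (f : 'I_k.+1 -> 'I_n.+1 * 'I_n.+1) r s :
  `|(\prod_l unit_block (f l)) r s| <= (r == (f ord0).1)%:R * n.+1%:R^-1 ^+ k.+1.
Proof.
have n0 : 0 <= n.+1%:R^-1 :> C by rewrite invr_ge0.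
have ub e r' s' : `|unit_block e r' s'| = (r' == e.1)%:R * n.+1%:R^-1.
  by rewrite !mxE !normrM norm_conjC !Hflat !mulr1 normr_nat ger0_norm.
elim: k f r s => [|k IH] f r s.
  by rewrite big_ord_recl big_ord0 mulr1 ub expr1.
rewrite big_ord_recl -mulmxE !mxE.
apply: le_trans (ler_norm_sum _ _ _) _.
apply: (@le_trans _ _ (\sum_j ((r == (f ord0).1)%:R * n.+1%:R^-1) *
   ((j == (f (lift ord0 ord0)).1)%:R * n.+1%:R^-1 ^+ k.+1))).
  apply: ler_sum => j _; rewrite normrM ub ler_wpM2l ?mulr_ge0//.
rewrite -mulr_sumr -mulr_suml (bigD1 (f (lift ord0 ord0)).1)//= eqxx.
rewrite big1 ?addr0 => [|j /negPf ->//].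
by rewrite mul1r -mulrA -exprS.
Qed.

Definition config_mean (F : {ffun 'I_n.+1 -> bool} -> {ffun 'I_n.+1 -> bool} -> C) : C :=
  \sum_x \sum_y bern_wt al x * bern_wt be y * F x y.

(** With K = k + 1 letters, the surviving row words number at most a constant times N^(K/2), rounded
    down in the exponent, and likewise the column words. Each term is at most N^-K, so the
    unnormalized trace has a mean bounded uniformly in N. *)
Lemma word_mean_bound k :
  `|config_mean (fun x y => \tr (((row_proj x - al%:A) * (had_proj y - be%:A)) ^+ k.+1))|
  <= ((k.+1)./2 ^ k.+1 * (k.+1)./2 ^ k.+1)%:R.
Proof.
pose B (f : {ffun 'I_k.+1 -> 'I_n.+1 * 'I_n.+1}) := \tr (\prod_l unit_block (f l)).
have tB f : `|B f| <= n.+1%:R^-1 ^+ k.+1.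
  apply: le_trans (ler_norm_sum _ _ _) _.
  apply: le_trans (ler_sum _ (fun i _ => unit_block_prod f i i)) _.
  rewrite -mulr_suml (bigD1 (f ord0).1)//= eqxx big1 ?addr0 ?mul1r//.
  by move=> j /negPf ->.
have E x y : \tr (((row_proj x - al%:A) * (had_proj y - be%:A)) ^+ k.+1) =
   \sum_(f : {ffun 'I_k.+1 -> 'I_n.+1 * 'I_n.+1})
     (\prod_l ((x (f l).1)%:R - al)) * (\prod_l ((y (f l).2)%:R - be)) * B f.
  rewrite row_had_expand -[in LHS](card_ord k.+1) -prodr_const.
  rewrite bigA_distr_bigA /= raddf_sum; apply: eq_bigr => f _.
  by rewrite scaler_prod /= mxtraceZ big_split.
have -> : config_mean (fun x y =>
      \tr (((row_proj x - al%:A) * (had_proj y - be%:A)) ^+ k.+1)) =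
   \sum_(f : {ffun 'I_k.+1 -> 'I_n.+1 * 'I_n.+1})
     (\sum_x bern_wt al x * \prod_l ((x (f l).1)%:R - al)) *
     (\sum_y bern_wt be y * \prod_l ((y (f l).2)%:R - be)) * B f.
  rewrite /config_mean.
  under eq_bigr do under eq_bigr do rewrite E mulr_sumr.
  under eq_bigr do rewrite exchange_big /=.
  rewrite exchange_big /=; apply: eq_bigr => f _.
  rewrite -mulrA mulr_suml; apply: eq_bigr => x _.
  rewrite mulr_suml mulr_sumr; apply: eq_bigr => y _; ring.
(* A word of index pairs is separated into its row word and its column word, which are counted
   independently. *)
pose fib (f : {ffun 'I_k.+1 -> 'I_n.+1 * 'I_n.+1}) :=
  ([ffun l => (f l).1], [ffun l => (f l).2]).
pose S := [set g : {ffun 'I_k.+1 -> 'I_n.+1} | no_singleton_fiber g].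
apply: le_trans (ler_norm_sum _ _ _) _.
apply: (@le_trans _ _ (\sum_(f | fib f \in finset.setX S S) n.+1%:R^-1 ^+ k.+1)).
  rewrite [leRHS]big_mkcond /=; apply: ler_sum => f _.
  rewrite !normrM.
  have m1 := bern_wt_centered_prod al01 (fun l => (f l).1).
  have m2 := bern_wt_centered_prod be01 (fun l => (f l).2).
  have e1 : no_singleton_fiber (fun l => (f l).1) = ((fib f).1 \in S).
    rewrite inE; apply: eq_forallb => i; congr (_ != _); apply: eq_card => l.
    by rewrite !inE ffunE.
  have e2 : no_singleton_fiber (fun l => (f l).2) = ((fib f).2 \in S).
    rewrite inE; apply: eq_forallb => i; congr (_ != _); apply: eq_card => l.
    by rewrite !inE ffunE.
  rewrite e1 in m1; rewrite e2 in m2; rewrite [fib f]surjective_pairing finset.in_setX.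
  apply: le_trans (_ : ((fib f).1 \in S)%:R * ((fib f).2 \in S)%:R * n.+1%:R^-1 ^+ k.+1 <= _).
    by rewrite !ler_pM ?mulr_ge0.
  by case: ((fib f).1 \in S); case: ((fib f).2 \in S); rewrite /= ?mul1r ?mulr0 ?mul0r.
rewrite sumr_const -[leLHS]mulr_natr exprVn mulrC ler_pdivrMr ?exprn_gt0 ?ltr0n//.
rewrite -natrX -natrM ler_nat.
have fib_inj : injective fib.
  move=> f g [/ffunP e1 /ffunP e2]; apply/ffunP => l.
  by have := e1 l; have := e2 l; rewrite !ffunE; case: (f l) (g l) => [? ?] [? ?] /= -> ->.
have -> : #|[pred f | fib f \in finset.setX S S]| = #|fib @^-1: finset.setX S S|.
  by apply: eq_card => f; rewrite !inE.
apply: leq_trans (_ : #|finset.setX S S| <= _)%N.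
  rewrite -(card_imset _ fib_inj); apply: subset_leq_card.
  by apply/fintype.subsetP => _ /imsetP[f fS ->]; rewrite inE in fS.
rewrite finset.cardsX.
apply: leq_trans (leq_mul (card_no_singleton_fiber _ _) (card_no_singleton_fiber _ _)) _.
(* What remains is the comparison of exponents: twice the half of k + 1 is at most k + 1. *)
rewrite mulnACA leq_mul2l; apply/orP; right.
by rewrite -expnD leq_pexp2l// addnn -[leqRHS](odd_double_half k.+1) leq_addl.
Qed.
End RandomProjections.

(** The rate O(1/N), with N = n + 1, is stated by an inequality, so the same notion applies over R
    and over R[i] without a topology. *)
Definition vanishing (C : numFieldType) (F : nat -> C) :=
  exists c : C, forall n, `|F n| <= c / n.+1%:R.

Section Vanishing.
Variable C : numFieldType.
Implicit Types F G : nat -> C.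

Lemma vanishing0 : vanishing (fun=> 0 : C).
Proof. by exists 0 => n; rewrite normr0 mul0r. Qed.

Lemma vanishing_ext F G : F =1 G -> vanishing F -> vanishing G.
Proof. by move=> FG [c Fc]; exists c => n; rewrite -FG. Qed.

Lemma vanishingD F G : vanishing F -> vanishing G -> vanishing (fun n => F n + G n).
Proof.
move=> [c Fc] [e Ge]; exists (c + e) => n; rewrite mulrDl.
exact: le_trans (ler_normD _ _) (lerD (Fc n) (Ge n)).
Qed.

Lemma vanishingZ k F : vanishing F -> vanishing (fun n => k * F n).
Proof.
by move=> [c Fc]; exists (`|k| * c) => n; rewrite normrM -mulrA ler_wpM2l.
Qed.
End Vanishing.

Section AsymptoticFreeness.
Variables (C : numClosedFieldType) (H : forall n, 'M[C]_n.+1).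
Hypotheses (Hflat : forall n i j, `|H n i j| = 1)
  (HHt : forall n, H n *m (H n)^t* = n.+1%:R%:M).
Variables al be : C.
Hypotheses (al01 : 0 <= al <= 1) (be01 : 0 <= be <= 1).

Definition trace_state n
    (F : {ffun 'I_n.+1 -> bool} -> {ffun 'I_n.+1 -> bool} -> 'M[C]_n.+1) : C :=
  config_mean al be (fun x y => \tr (F x y)) / n.+1%:R.

Let p n (x y : {ffun 'I_n.+1 -> bool}) := row_proj C x.
Let q n (x y : {ffun 'I_n.+1 -> bool}) := had_proj (H n) y.
Let a n x y := @p n x y - al%:A.
Let b n x y := @q n x y - be%:A.
Let s := 1 - 2 * al.
Let t := 1 - 2 * be.
Let u := al * (1 - al).
Let w := be * (1 - be).

Lemma config_mean_ext n (F G : {ffun 'I_n.+1 -> bool} -> {ffun 'I_n.+1 -> bool} -> C) :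
  (forall x y, F x y = G x y) -> config_mean al be F = config_mean al be G.
Proof. by move=> FG; do 2!apply: eq_bigr => ? _; rewrite FG. Qed.

Lemma config_meanD n (F G : {ffun 'I_n.+1 -> bool} -> {ffun 'I_n.+1 -> bool} -> C) :
  config_mean al be (fun x y => F x y + G x y) = config_mean al be F + config_mean al be G.
Proof.
rewrite /config_mean -big_split; apply: eq_bigr => x _ /=.
by rewrite -big_split; apply: eq_bigr => y _ /=; rewrite mulrDr.
Qed.

Lemma config_meanZ n k (F : {ffun 'I_n.+1 -> bool} -> {ffun 'I_n.+1 -> bool} -> C) :
  config_mean al be (fun x y => k * F x y) = k * config_mean al be F.
Proof.
rewrite /config_mean mulr_sumr; apply: eq_bigr => x _ /=.
by rewrite mulr_sumr; apply: eq_bigr => y _ /=; rewrite mulrCA.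
Qed.

Lemma config_mean_row n (F : {ffun 'I_n.+1 -> bool} -> C) :
  config_mean al be (fun x _ => F x) = \sum_x bern_wt al x * F x.
Proof.
apply: eq_bigr => x _; rewrite -mulr_suml -mulr_sumr.
by rewrite bern_wt_sum mulr1.
Qed.

Lemma config_mean_col n (F : {ffun 'I_n.+1 -> bool} -> C) :
  config_mean al be (fun _ y => F y) = \sum_y bern_wt be y * F y.
Proof.
rewrite /config_mean exchange_big; apply: eq_bigr => x _ /=.
by rewrite -mulr_suml -mulr_suml bern_wt_sum mul1r.
Qed.

Lemma config_mean_cst n (k : C) :
  config_mean al be (fun _ _ : {ffun 'I_n.+1 -> bool} => k) = k.
Proof. by rewrite config_mean_row -mulr_suml bern_wt_sum mul1r. Qed.

(** Carries an identity of the shape of [trace_compression_cheb], with six words on the right, from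
    each configuration to the mean. *)
Lemma trace_state_lincomb n (k0 k1 k2 k3 k4 k5 k6 : C)
    (F0 F1 F2 F3 F4 F5 F6 :
       {ffun 'I_n.+1 -> bool} -> {ffun 'I_n.+1 -> bool} -> 'M[C]_n.+1) :
  (forall x y, k0 * \tr (F0 x y) = k1 * \tr (F1 x y) + k2 * \tr (F2 x y)
     + (k3 * \tr (F3 x y) + k4 * \tr (F4 x y))
     + (k5 * \tr (F5 x y) + k6 * \tr (F6 x y))) ->
  k0 * trace_state F0 = k1 * trace_state F1 + k2 * trace_state F2
     + (k3 * trace_state F3 + k4 * trace_state F4)
     + (k5 * trace_state F5 + k6 * trace_state F6).
Proof.
move=> FE; rewrite /trace_state !mulrA -!mulrDl; congr (_ / _).
by rewrite -!config_meanZ -!config_meanD; exact: config_mean_ext.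
Qed.

Lemma vanishing_word k : vanishing (fun n => trace_state (fun x y => (@a n x y * b x y) ^+ k.+1)).
Proof.
exists ((k.+1)./2 ^ k.+1 * (k.+1)./2 ^ k.+1)%:R => n.
rewrite normrM normfV normr_nat ler_wpM2r ?invr_ge0//.
exact: (word_mean_bound (@Hflat n) (HHt n) al01 be01 k).
Qed.

Lemma row_centered n : config_mean al be (fun x y => \tr (@a n x y)) = 0.
Proof.
rewrite (config_mean_row (fun x => \tr (row_proj C x - al%:A))).
under eq_bigr => x _.
  rewrite (_ : \tr _ = \sum_i ((x i)%:R - al)); last first.
    by apply: eq_bigr => i _; rewrite !mxE eqxx !mulr1n mulr1.
  rewrite mulr_sumr; over.
by rewrite exchange_big big1// => i _; rewrite bern_wt_centered.
Qed.

Lemma had_centered n : config_mean al be (fun x y => \tr (@b n x y)) = 0.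
Proof.
have n0 : n.+1%:R != 0 :> C by rewrite pnatr_eq0.
rewrite (config_mean_col (fun y => \tr (had_proj (H n) y - be%:A))).
under eq_bigr => y _.
  (* By cyclicity and H^* H = N, the trace of the Hadamard projection is that of its diagonal
     factor. *)
  rewrite (_ : \tr _ = \sum_i ((y i)%:R - be)); last first.
    rewrite raddfB /= mxtraceZ mxtrace_mulC mulmxA (had_adjmul (HHt n)).
    rewrite mul_scalar_mx mxtraceZ mulKf// mxtrace_diag mxtraceZ mxtrace1 sumrB.
    by rewrite sumr_const card_ord mulr_natr; congr (_ - _); apply: eq_bigr => i _; rewrite mxE.
  rewrite mulr_sumr; over.
by rewrite exchange_big big1// => i _; rewrite bern_wt_centered.
Qed.

(** [mxtrace_oddS] reduces an odd word to an even one, which vanishes by [vanishing_word], and a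
    shorter odd word with the letters exchanged. Hence both kinds are treated together; single
    letters have mean exactly 0. *)
Lemma vanishing_odd k :
  vanishing (fun n => trace_state (fun x y => @a n x y * (b x y * a x y) ^+ k)) /\
  vanishing (fun n => trace_state (fun x y => @b n x y * (a x y * b x y) ^+ k)).
Proof.
elim: k => [|k [IHa IHb]].
  split; apply: vanishing_ext (vanishing0 _) => n; rewrite /trace_state.
    rewrite (config_mean_ext (G := fun x y => \tr (a x y))) ?row_centered ?mul0r//.
    by move=> x y; rewrite expr0 mulr1.
  rewrite (config_mean_ext (G := fun x y => \tr (b x y))) ?had_centered ?mul0r//.
  by move=> x y; rewrite expr0 mulr1.
have aa n (x y : {ffun 'I_n.+1 -> bool}) : a x y * a x y = s *: a x y + u%:A :=
  centered_idem_sq al (row_proj_idem (n := n) C x).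
have bb n (x y : {ffun 'I_n.+1 -> bool}) : b x y * b x y = t *: b x y + w%:A :=
  centered_idem_sq be (had_proj_idem (HHt n) y).
split.
- apply: vanishing_ext (vanishingD (vanishingZ s (vanishing_word k)) (vanishingZ u IHb)) => n.
  rewrite /trace_state mulrA [u * _]mulrA -mulrDl -!config_meanZ -config_meanD.
  congr (_ / _); apply: config_mean_ext => x y.
  by rewrite (mxtrace_oddS (b x y) (aa n x y)) mxtrace_expr_mulC.
- apply: vanishing_ext (vanishingD (vanishingZ t (vanishing_word k)) (vanishingZ w IHa)) => n.
  rewrite /trace_state mulrA [w * _]mulrA -mulrDl -!config_meanZ -config_meanD.
  congr (_ / _); apply: config_mean_ext => x y.
  by rewrite (mxtrace_oddS (a x y) (bb n x y)).
Qed.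

(** The integral of f against the mean spectral distribution of pqp. *)
Definition mean_spectral n (f : {poly C}) : C :=
  trace_state (fun x y => horner_mx (@p n x y * q x y * p x y) f).

(** The trace of pqp is that of pq. Expanding both projections about their means leaves the constant
    and the word ab, since single centred letters have mean 0. *)
Lemma mean_spectralX : vanishing (fun n => mean_spectral n 'X - al * be).
Proof.
apply: vanishing_ext (vanishing_word 0) => n.
have n0 : n.+1%:R != 0 :> C by rewrite pnatr_eq0.
have -> : mean_spectral n 'X = (config_mean al be (fun x y => \tr (@a n x y * b x y))
   + be * config_mean al be (fun x y => \tr (@a n x y))
   + al * config_mean al be (fun x y => \tr (@b n x y))
   + config_mean (n := n) al be (fun _ _ => al * be * n.+1%:R)) / n.+1%:R.
  rewrite -!config_meanZ -!config_meanD; congr (_ / _); apply: config_mean_ext => x y.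
  rewrite horner_mx_X mxtrace_mulrC mulrA row_proj_idem.
  exact: mxtrace_mul_centered.
by rewrite row_centered had_centered config_mean_cst !mulr0 !addr0 mulrDl mulfK// addrK.
Qed.

(** Half of [trace_compression_cheb], averaged: every word there vanishes except (ab)^m for m = 0,
    which has state 1 and coefficient uw. *)
Lemma mean_spectral_cheb m :
  vanishing (fun n => mean_spectral n
    (('X - 'X^2) * cheb (al + be - 2 * al * be) (u * w) m) - u * w * (m == 0%N)%:R).
Proof.
have two : 2 != 0 :> C by rewrite pnatr_eq0.
have v0 : vanishing (fun n => trace_state (fun x y => (@a n x y * b x y) ^+ m)
    - (m == 0%N)%:R).
  case: m => [|m]; last first.
    by apply: vanishing_ext (vanishing_word m) => n; rewrite subr0.
  apply: vanishing_ext (vanishing0 _) => n; rewrite /trace_state.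
  rewrite (config_mean_ext (G := fun _ _ => n.+1%:R)).
    by rewrite config_mean_cst divff ?subrr// pnatr_eq0.
  by move=> x y; rewrite expr0 mxtrace1.
have [vA vB] := vanishing_odd m; have [vA' vB'] := vanishing_odd m.+1.
have vT := vanishing_word m.+1.
apply: vanishing_ext (vanishingD (vanishingD (vanishingZ (u * w) v0)
  (vanishingZ (-1) vT)) (vanishingZ 2^-1 (vanishingD
   (vanishingD (vanishingZ s vB') (vanishingZ (u * t) vB))
   (vanishingD (vanishingZ t vA') (vanishingZ (w * s) vA))))) => n.
have E : 2 * mean_spectral n (('X - 'X^2) * cheb (al + be - 2 * al * be) (u * w) m) =
  2 * (u * w) * trace_state (fun x y => (@a n x y * b x y) ^+ m)
   + (- 2) * trace_state (fun x y => (@a n x y * b x y) ^+ m.+2)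
  + (s * trace_state (fun x y => @b n x y * (a x y * b x y) ^+ m.+1)
     + u * t * trace_state (fun x y => @b n x y * (a x y * b x y) ^+ m))
  + (t * trace_state (fun x y => @a n x y * (b x y * a x y) ^+ m.+1)
     + w * s * trace_state (fun x y => @a n x y * (b x y * a x y) ^+ m)).
  apply: trace_state_lincomb => x y.
  apply: (etrans (trace_compression_cheb al be (row_proj_idem C x)
    (had_proj_idem (HHt n) y) m)).
  by rewrite mulNr.
apply: (mulfI two); rewrite [in RHS]mulrBr E.
have -> (X Y : C) : 2 * (X + 2^-1 * Y) = 2 * X + Y by rewrite mulrDr mulVKf.
ring.
Qed.
End AsymptoticFreeness.

Local Open Scope classical_set_scope.
Local Open Scope ring_scope.

(** * Measures with density and finite mixtures *)

(** Nonnegativity and measurability of f are arguments so that the measure structure can be inferred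
    from the term. *)
Definition density_measure (R : realType) (f : R -> R)
    (f0 : forall x, 0 <= f x) (mf : measurable_fun setT f)
    (A : set (measurableTypeR R)) : \bar R :=
  (\int[lebesgue_measure]_(x in A) (f x)%:E)%E.

Section DensityMeasure.
Context {R : realType}.
Variables (f : R -> R) (f0 : forall x, 0 <= f x) (mf : measurable_fun setT f).
Notation mu := (@lebesgue_measure R).
Notation dens := (density_measure f0 mf).

Let dens0 : dens set0 = 0%E.
Proof. by rewrite /density_measure integral_set0. Qed.

Let dens_ge0 A : (0 <= dens A)%E.
Proof. by apply: integral_ge0 => x _; rewrite lee_fin. Qed.

Let dens_sigma_additive : semi_sigma_additive dens.
Proof.
move=> /= F mF tF mUF; rewrite /density_measure; apply: cvg_toP.
  apply: ereal_nondecreasing_is_cvgn => m n mn.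
  apply: lee_sum_nneg_natr => // k _ _.
  by apply: integral_ge0 => /= x Fkx; rewrite lee_fin.
rewrite ge0_integral_bigcup//=.
- by apply/measurable_EFinP; apply: measurable_funTS.
- by move=> x _; rewrite lee_fin.
Qed.

HB.instance Definition _ := isMeasure.Build _ _ _ dens
  dens0 dens_ge0 dens_sigma_additive.

Import HBNNSimple.

Let integral_dens_nnsfun (g : {nnsfun (measurableTypeR R) >-> R}) :
  (\int[dens]_x (g x)%:E = \int[mu]_x ((g x)%:E * (f x)%:E))%E.
Proof.
under [LHS]eq_integral do rewrite fimfunE -fsumEFin//.
rewrite [LHS]ge0_integral_fsum//; last 2 first.
  - by move=> r; exact/measurable_EFinP/measurableT_comp.
  - by move=> n x _; rewrite EFinM nnfun_muleindic_ge0.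
under [RHS]eq_integral.
  move=> x xD; rewrite fimfunE -fsumEFin// ge0_mule_fsuml; last first.
    by move=> r; rewrite EFinM nnfun_muleindic_ge0.
  over.
rewrite [RHS]ge0_integral_fsum//; last 2 first.
  - move=> r; apply: emeasurable_funM; last exact/measurable_EFinP.
    by apply/measurable_EFinP; do 2 apply/measurableT_comp => //.
  - by move=> n x _; rewrite mule_ge0//; rewrite ?EFinM ?nnfun_muleindic_ge0// lee_fin.
apply: eq_fsbigr => r rg.
under eq_integral do rewrite EFinM.
under [RHS]eq_integral do rewrite EFinM -muleA.
(* A negative r is not a value of g, so its level set is empty; for the others the scalar comes out
   of the integral. *)
have [r0|r0] := ltP r 0.
  have g0 : g @^-1` [set r] = set0.
    by apply/seteqP; split => // x /= gx; have : 0 <= g x by []; rewrite gx leNgt r0.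
  by rewrite g0 indic0 !integral0_eq// => x _ /=; rewrite ?mul0e mule0.
rewrite !ge0_integralZl//.
- congr (_ * _)%E; rewrite integral_indic//= setIT /density_measure.
  rewrite integral_mkcond; apply: eq_integral => x _; rewrite patchE indicE.
  by case: (_ \in _); rewrite ?mul1e ?mul0e.
- apply: emeasurable_funM; last exact/measurable_EFinP.
  exact/measurable_EFinP.
- by move=> x _; rewrite mule_ge0// lee_fin.
- exact/measurable_EFinP.
Qed.

(** Known for simple functions; both sides pass to the limit along an increasing approximation of g
    by monotone convergence. *)
Lemma ge0_integral_density (g : R -> \bar R) :
  measurable_fun setT g -> (forall x, 0 <= g x)%E ->
  (\int[dens]_x g x = \int[mu]_x (g x * (f x)%:E))%E.
Proof.
move=> mg g0.
pose g_ := nnsfun_approx (measurableT : measurable (setT : set (measurableTypeR R))) mg.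
transitivity (lim (\int[dens]_x (g_ n x)%:E @[n --> \oo])%E).
  rewrite -monotone_convergence//=.
  - apply: eq_integral => ? /[!inE] xD; apply/esym/cvg_lim => //=.
    exact: cvg_nnsfun_approx.
  - by move=> n; exact/measurable_EFinP/measurable_funTS.
  - by move=> n ? _; rewrite lee_fin.
  - by move=> ? _ ? ? mn; rewrite lee_fin; exact/lefP/nd_nnsfun_approx.
transitivity (lim (\int[mu]_x ((g_ n x)%:E * (f x)%:E) @[n --> \oo])%E).
  by apply: congr_lim; apply/funext => n /=; exact: integral_dens_nnsfun.
rewrite -monotone_convergence//=.
- apply: eq_integral => x /[!inE] xD; apply/cvg_lim => //.
  apply: cvgeZr => //; exact: cvg_nnsfun_approx.
- by move=> n; apply: emeasurable_funM; exact/measurable_EFinP.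
- by move=> n ? _; rewrite mule_ge0// lee_fin.
- move=> x _ m n mn; rewrite lee_pmul// ?lee_fin//.
  exact/lefP/nd_nnsfun_approx.
Qed.

End DensityMeasure.

Section Mixture.
Context {R : realType}.
Variables (n : nat) (w t : nat -> R) (f : R -> R).
Hypotheses (w0 : forall i, 0 <= w i) (f0 : forall x, 0 <= f x)
  (mf : measurable_fun setT f).
Notation mu := (@lebesgue_measure R).

Let atoms i : {measure set (measurableTypeR R) -> \bar R} :=
  mscale (NngNum (w0 i)) (@dirac _ (measurableTypeR R) (t i) R).
Let mix : {measure set (measurableTypeR R) -> \bar R} :=
  measure_add (msum atoms n) (density_measure f0 mf).

Let mixE A : mix A = (\sum_(i < n) (w i)%:E * \d_(t i) A +
  \int[mu]_(x in A) (f x)%:E)%E.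
Proof. exact: measure_addE. Qed.

Let ge0_integral_mix (g : R -> \bar R) :
  measurable_fun setT g -> (forall x, 0 <= g x)%E ->
  (\int[mix]_x g x = \sum_(i < n) (w i)%:E * g (t i) + \int[mu]_x (g x * (f x)%:E))%E.
Proof.
move=> mg g0; rewrite ge0_integral_measure_add// ge0_integral_density//.
congr (_ + _)%E; rewrite ge0_integral_measure_sum//.
apply: eq_bigr => i _; rewrite ge0_integral_mscale//=.
by rewrite integral_dirac// diracT mul1e.
Qed.

Hypothesis mass1 : (\sum_(i < n) (w i)%:E + \int[mu]_x (f x)%:E = 1)%E.

(** For nonnegative g the formula is additivity in the measure. The general case is the difference
    of those for the positive and negative parts of g. *)
Lemma mixture_exists : exists nu : probability (measurableTypeR R) R,
  (forall A, measurable A -> nu A = (\sum_(i < n) (w i)%:E * \d_(t i) A +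
    \int[mu]_(x in A) (f x)%:E)%E) /\
  (forall g : R -> R, measurable_fun setT g ->
     mu.-integrable setT (EFin \o (fun x => g x * f x)) ->
   nu.-integrable setT (EFin \o g) /\
   (\int[nu]_x (g x)%:E = (\sum_(i < n) w i * g (t i))%:E
      + \int[mu]_x (g x * f x)%:E)%E).
Proof.
have mixT : mix setT = 1%E.
  rewrite mixE -[RHS]mass1; congr (_ + _)%E; apply: eq_bigr => i _.
  rewrite diracT. exact: mule1.
(* The total mass is 1, so normalization changes nothing and only supplies the probability
   structure; the Dirac mass is its default for degenerate mass. *)
pose nu : probability (measurableTypeR R) R :=
  mnormalize mix (@dirac _ (measurableTypeR R) 0 R).
have nuE A : nu A = mix A.
  rewrite /nu /= /mnormalize mixT onee_eq0 /= invr1. exact: mule1.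
have nuI (g : R -> \bar R) : (\int[nu]_x g x = \int[mix]_x g x)%E.
  by apply: eq_measure_integral => A _ _; exact: nuE.
exists nu; split=> [A mA|g mg ig]; first by rewrite nuE mixE.
have mEg : measurable_fun setT (EFin \o g) by exact/measurable_EFinP.
have posE (h : R -> R) : measurable_fun setT h -> (forall x, 0 <= h x) ->
    (\int[nu]_x (h x)%:E = (\sum_(i < n) w i * h (t i))%:E
      + \int[mu]_x (h x * f x)%:E)%E.
  move=> mh h0; rewrite nuI ge0_integral_mix; last 2 first.
    by exact/measurable_EFinP.
    by move=> x; rewrite lee_fin.
  by rewrite -sumEFin.
have ig' : nu.-integrable setT (EFin \o g).
  apply/integrableP; split=> //=.
  rewrite posE//; last exact: measurableT_comp.
  rewrite lte_add_pinfty ?ltry//.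
  have /integrableP[_] := ig; congr (_ < _)%E; apply: eq_integral => x _ /=.
  by rewrite normrM (ger0_norm (f0 x)).
split=> //.
have split_ph (x : R) : g x = g^\+ x - g^\- x by rewrite -[in LHS](funrposBneg g).
have mp : measurable_fun setT g^\+ by exact: measurable_funrpos.
have mn : measurable_fun setT g^\- by exact: measurable_funrneg.
have ipn : nu.-integrable setT (EFin \o g^\+) by exact: integrable_funrpos.
have inn : nu.-integrable setT (EFin \o g^\-) by exact: integrable_funrneg.
(* As f is nonnegative, taking positive or negative parts commutes with multiplying by f. *)
have pE x : g^\+ x * f x = (fun x => g x * f x)^\+ x.
  by rewrite /funrpos /= maxr_pMl// mul0r.
have nE x : g^\- x * f x = (fun x => g x * f x)^\- x.
  by rewrite /funrneg /= maxr_pMl// mul0r mulNr.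
have ipf : mu.-integrable setT (EFin \o (fun x => g^\+ x * f x)).
  by under eq_fun do rewrite pE; exact: integrable_funrpos.
have inf : mu.-integrable setT (EFin \o (fun x => g^\- x * f x)).
  by under eq_fun do rewrite nE; exact: integrable_funrneg.
under eq_integral do rewrite split_ph EFinB.
rewrite integralB_EFin//= !posE ?funrpos_ge0 ?funrneg_ge0//.
under [X in (_ = _ + X)%E]eq_integral do rewrite {1}split_ph mulrBl EFinB.
rewrite integralB_EFin//.
rewrite fin_num_oppeD; last by apply: integrable_fin_num.
rewrite addeACA; congr (_ + _)%E.
rewrite -EFinB -sumrB; congr (_%:E); apply: eq_bigr => i _.
by rewrite -mulrBr -split_ph.
Qed.
End Mixture.

Lemma finite_mixture_exists (R : realType) (I : finType) (w t : I -> R) :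
  (forall i, 0 <= w i) -> \sum_i w i = 1 ->
  exists nu : probability (measurableTypeR R) R,
  (forall A, measurable A -> nu A = (\sum_i w i * \1_A (t i))%:E) /\
  (forall g : R -> R, measurable_fun setT g ->
   nu.-integrable setT (EFin \o g) /\
   (\int[nu]_x (g x)%:E = (\sum_i w i * g (t i))%:E)%E).
Proof.
move=> w0 w1.
(* The family is reindexed by natural numbers through the enumeration of I; the default 0 keeps the
   weights nonnegative. *)
pose ext (h : I -> R) (k : nat) : R :=
  if (insub k : option 'I_#|I|) is Some j then h (enum_val j) else 0.
have extE h (j : 'I_#|I|) : ext h j = h (enum_val j).
  by rewrite /ext valK.
have reindex (h : I -> R) : \sum_i h i = \sum_(j < #|I|) h (enum_val j).
  by rewrite -big_enum_val.
have ew0 k : 0 <= ext w k by rewrite /ext; case: insubP.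
have zm : measurable_fun (setT : set R) (fun=> 0 : R) by exact: measurable_cst.
have mass : (\sum_(i < #|I|) (ext w i)%:E +
    \int[@lebesgue_measure R]_x ((fun=> 0) x)%:E = 1)%E.
  rewrite integral0 adde0 sumEFin -w1 reindex; congr (_%:E).
  by apply: eq_bigr => j _; rewrite extE.
have [nu [nuA nug]] := mixture_exists (ext t) ew0 (fun=> lexx 0) zm mass.
exists nu; split=> [A mA|g mg].
  rewrite nuA// integral0 adde0 reindex -sumEFin; apply: eq_bigr => j _.
  by rewrite !extE EFinM.
have [|ig ->] := nug _ mg.
  by under eq_fun do rewrite mulr0; exact: integrable0.
split=> //; under eq_integral do rewrite mulr0.
rewrite integral0 adde0 reindex; congr (_%:E).
by apply: eq_bigr => j _; rewrite !extE.
Qed.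

(** * Expectations determined by finitely many events *)

Section ExpectationFiniteTypes.
Context d (T : measurableType d) (R : realType) (P : probability T R).

(* Monotonicity holds without measurability, since the integral of a
   nonnegative function is a supremum over the simple functions below it. *)
Lemma le_integral_ge0_nonmeas (f g : T -> \bar R) :
  (forall x, 0 <= f x)%E -> (forall x, f x <= g x)%E ->
  (\int[P]_x f x <= \int[P]_x g x)%E.
Proof.
move=> f0 fg; have g0 x : (0 <= g x)%E := le_trans (f0 x) (fg x).
rewrite !ge0_integralTE//; apply: ereal_sup_le => _ [h hf <-]; exists h => //.
by move=> x; exact: le_trans (hf x) (fg x).
Qed.

(* F need not be measurable: nothing is assumed outside the union of the E c,
   which has full measure. *)
Lemma expectation_finite_partition (I : finType) (E : I -> set T) (v p : I -> R)
    (F : T -> R) :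
  (forall c, measurable (E c)) -> trivIset setT E ->
  (forall c, P (E c) = (p c)%:E) -> \sum_c p c = 1 ->
  (forall x, 0 <= F x <= 1) -> (forall c x, E c x -> F x = v c) ->
  (forall c, 0 <= v c) ->
  ('E_P[F] = (\sum_c p c * v c)%:E)%E.
Proof.
move=> mE tE PE p1 F01 FE v0.
have F0 x : 0 <= F x by case/andP: (F01 x).
have F1 x : F x <= 1 by case/andP: (F01 x).
pose D := \bigcup_(c in [set: I]) E c.
have mD : measurable D by apply: fin_bigcup_measurable => //; exact: finite_finset.
have PD : P D = 1%E.
  rewrite /D measure_fin_bigcup//; last exact: finite_finset.
  rewrite (fsbigE (index_enum I)) ?index_enum_uniq//; last first.
    by move=> c _; rewrite mem_index_enum.
  rewrite (eq_bigl xpredT) => [|c]; last exact: in_setT.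
  by rewrite (eq_bigr (fun c => (p c)%:E)) ?sumEFin ?p1// => c _; exact: PE.
(* G equals F on D and 0 elsewhere, so F lies between G and G plus the indicator of the null
   complement of D. *)
pose G x : \bar R := (\sum_c (v c * \1_(E c) x)%:E)%E.
have mG : measurable_fun setT G.
  apply: emeasurable_sum => c; apply/measurable_EFinP; apply: measurable_funM => //.
have G0 x : (0 <= G x)%E by apply: sume_ge0 => c _; rewrite lee_fin mulr_ge0.
have IG : (\int[P]_x G x = (\sum_c p c * v c)%:E)%E.
  rewrite ge0_integral_sum//.
  - rewrite -sumEFin; apply: eq_bigr => c _.
    under eq_integral do rewrite EFinM.
    rewrite ge0_integralZl//; last 2 first.
      by apply/measurable_EFinP.
      by rewrite lee_fin.
    rewrite integral_indic// setIT EFinM muleC; congr (_ * _)%E; exact: PE.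
  - by move=> c; apply/measurable_EFinP; apply: measurable_funM.
  - by move=> c x _; rewrite lee_fin mulr_ge0.
have GD c x : E c x -> G x = (F x)%:E.
  move=> Ex; rewrite /G (bigD1 c)//= big1 ?adde0 => [|c' c'c].
    by rewrite indicE mem_set// mulr1 (FE _ _ Ex).
  rewrite indicE memNset ?mulr0// => Ex'.
  by move/eqP: c'c; apply; apply: tE => //; exists x.
rewrite unlock; apply/eqP; rewrite eq_le; apply/andP; split.
- apply: (@le_trans _ _ (\int[P]_x (G x + (\1_(~` D) x)%:E))%E).
    apply: le_integral_ge0_nonmeas => x; first by rewrite lee_fin.
    have [[c _ Ex]|nD] := pselect (D x).
      by rewrite (GD c)// leeDl// lee_fin.
    rewrite [X in (_ <= _ + X%:E)%E]indicE mem_set//.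
    by apply: le_trans (leeDr _ (G0 x)); rewrite lee_fin.
  have mDC : measurable_fun setT (EFin \o \1_(~` D) : T -> \bar R).
    by apply/measurable_EFinP; apply: measurable_indic; exact: measurableC.
  rewrite ge0_integralD//.
  have PDC : P (~` D) = 0%E by rewrite probability_setC// PD subee.
  rewrite (_ : (\int[P]_x (\1_(~` D) x)%:E)%E = 0%E) ?IG ?adde0//.
  by rewrite integral_indic ?setIT//; exact: measurableC.
- rewrite -IG; apply: le_integral_ge0_nonmeas => // x.
  have [[c _ Ex]|nD] := pselect (D x); first by rewrite (GD c).
  rewrite /G big1 ?lee_fin// => c _.
  by rewrite indicE memNset ?mulr0// => Ex; apply: nD; exists c.
Qed.
End ExpectationFiniteTypes.

(** * The mean spectral distribution as a finite mixture *)

Section ConfigurationEvents.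
Context d (T : measurableType d) (R : realType) (P : probability T R).
Variables (al be : R) (X Y : {RV P >-> R}) (Xs Ys : nat -> {RV P >-> R}).
Hypotheses
  (hX1 : P [set w | X w = 1] = al%:E) (hX0 : P [set w | X w = 0] = (1 - al)%:E)
  (hY1 : P [set w | Y w = 1] = be%:E) (hY0 : P [set w | Y w = 0] = (1 - be)%:E)
  (hXY : indep_rv P X Y)
  (hiid : iid_copies P (fun w => (X w, Y w)) (fun i w => (Xs i w, Ys i w))).

Definition config_event N (c : {ffun 'I_N -> bool} * {ffun 'I_N -> bool}) : set T :=
  [set w | forall i : 'I_N, Xs i w = (c.1 i)%:R /\ Ys i w = (c.2 i)%:R].

Let pair_prob (b b' : bool) :
  P [set w | X w = b%:R /\ Y w = b'%:R] = (bern al b * bern be b')%:E.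
Proof.
have -> : [set w | X w = b%:R /\ Y w = b'%:R] =
    X @^-1` [set b%:R] `&` Y @^-1` [set b'%:R] by [].
rewrite hXY// EFinM; congr (_ * _)%E.
  by case: b; [exact: hX1|exact: hX0].
by case: b'; [exact: hY1|exact: hY0].
Qed.

Lemma config_event_measurable N c : measurable (@config_event N c).
Proof.
have -> : config_event c = \bigcap_(i in [set: 'I_N])
    (Xs i @^-1` [set (c.1 i)%:R] `&` Ys i @^-1` [set (c.2 i)%:R]).
  by apply/seteqP; split => [w h i _|w h i]; [exact: h|exact: (h i I)].
apply: fin_bigcap_measurable => [|i _]; first exact: finite_finset.
by apply: measurableI; exact: measurable_funPTI.
Qed.

Lemma config_event_prob N c :
  P (@config_event N c) = (bern_wt al c.1 * bern_wt be c.2)%:E.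
Proof.
have [indep same] := hiid.
(* Independence asks for one set per natural number; indices from N on receive the whole space. *)
pose A (i : nat) : set (R * R) := if (insub i : option 'I_N) is Some j then
  [set (c.1 j)%:R] `*` [set (c.2 j)%:R] else setT.
have mA i : measurable (A i).
  rewrite /A; case: insubP => [j _ _|_]; last exact: measurableT.
  exact: measurableX.
have AE (j : 'I_N) : A j = [set (c.1 j)%:R] `*` [set (c.2 j)%:R].
  by rewrite /A valK.
pose J := [fset i | i in iota 0 N]%fset.
have -> : config_event c =
    \bigcap_(i in [set` J]) ((fun w => (Xs i w, Ys i w)) @^-1` A i).
  apply/seteqP; split => [w h i|w h i].
    rewrite /= !inE /= mem_iota add0n /= => iN.
    by rewrite (AE (Ordinal iN)) /=; exact: (h (Ordinal iN)).
  have := h i; rewrite /= !inE /= mem_iota add0n /= => /(_ (ltn_ord i)).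
  by rewrite AE.
rewrite indep//.
have -> : (\prod_(i <- J) P ((fun w => (Xs i w, Ys i w)) @^-1` A i) =
    \prod_(i <- iota 0 N) P ((fun w => (Xs i w, Ys i w)) @^-1` A i))%E.
  apply: perm_big; apply: uniq_perm; rewrite ?fset_uniq ?iota_uniq// => i.
  by rewrite !inE.
rewrite (_ : iota 0 N = index_iota 0 N) ?big_mkord; last by rewrite /index_iota subn0.
rewrite /bern_wt -big_split /= -prodEFin; apply: eq_bigr => i _.
by rewrite same// AE -pair_prob.
Qed.

Lemma config_event_trivIset N : trivIset setT (@config_event N).
Proof.
have inj (b b' : bool) : b%:R = b'%:R :> R -> b = b'.
  by move=> /eqP; rewrite eqr_nat; case: b; case: b'.
move=> [x y] [x' y'] _ _ [w [h h']]; congr (_, _); apply/ffunP => i.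
  by have [/= e _] := h i; have [/= e' _] := h' i; apply: inj; rewrite -e -e'.
by have [/= _ e] := h i; have [/= _ e'] := h' i; apply: inj; rewrite -e -e'.
Qed.
End ConfigurationEvents.

Local Open Scope complex_scope.

Lemma mxtrace_horner_normal (C : numClosedFieldType) n (M : 'M[C]_n.+1) (f : {poly C}) :
  M \is normalmx -> \tr (horner_mx M f) = \sum_i f.[spectral_diag M 0 i].
Proof.
move=> /orthomx_spectralP ME.
rewrite {1}ME horner_mx_uconjC ?spectral_unit// mxtrace_mulC mulmxA.
rewrite mulmxV ?spectral_unit// mul1mx horner_mx_diag mxtrace_diag.
by apply: eq_bigr => i _; rewrite mxE.
Qed.

(** The normalizing root is real with square N, so conjugation fixes it and it can be cleared from
    the unitarity relation. *)
Lemma complex_hadamardP (R : realType) n (H : 'M[R[i]]_n.+1) :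
  complex_hadamard H ->
  (forall i j, `|H i j| = 1) /\ H *m H^t* = n.+1%:R%:M.
Proof.
move=> [/unitarymxP U Hflat]; split=> //.
set r := (Num.sqrt n.+1%:R : R)%:C in U.
have r2 : r * r = n.+1%:R.
  by rewrite /r -rmorphM -expr2 sqr_sqrtr ?ler0n//= rmorph_nat.
have r0 : r != 0.
  by apply: contra_eq_neq r2 => ->; rewrite mul0r eq_sym pnatr_eq0.
have rJ : Num.conj r = r by apply/conj_Creal/complex_realP; exists (Num.sqrt n.+1%:R).
move: U; rewrite linearZ /= map_mxZ -scalemxAl -scalemxAr scalerA fmorphV /= rJ.
by move/(congr1 ( *:%R (r * r))); rewrite scalerA -invfM mulfV ?mulf_neq0// scale1r scalemx1 r2.
Qed.

Section SpectralMixture.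
Context (R : realType) (n : nat) (H : 'M[R[i]]_n.+1).

Definition compression (c : {ffun 'I_n.+1 -> bool} * {ffun 'I_n.+1 -> bool}) : 'M[R[i]]_n.+1 :=
  row_proj _ c.1 * had_proj H c.2 * row_proj _ c.1.

Lemma XHYHX_compression (c : {ffun 'I_n.+1 -> bool} * {ffun 'I_n.+1 -> bool})
    (x y : nat -> R) :
  (forall i : 'I_n.+1, x i = (c.1 i)%:R /\ y i = (c.2 i)%:R) ->
  XHYHX H x y = compression c.
Proof.
move=> xy; rewrite /XHYHX /compression /row_proj /had_proj -!mulmxE.
have -> : diag_of n.+1 x = diag_mx (\row_i (c.1 i)%:R) :> 'M[R[i]]_n.+1.
  congr diag_mx; apply/rowP => i; rewrite !mxE.
  by have [-> _] := xy i; rewrite rmorph_nat.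
have -> : diag_of n.+1 y = diag_mx (\row_i (c.2 i)%:R) :> 'M[R[i]]_n.+1.
  congr diag_mx; apply/rowP => i; rewrite !mxE.
  by have [_ ->] := xy i; rewrite rmorph_nat.
by rewrite -!scalemxAr -!scalemxAl !mulmxA.
Qed.

Lemma compression_hermitian c : compression c \is hermsymmx.
Proof.
have diagJ (x : {ffun 'I_n.+1 -> bool}) :
    (diag_mx (\row_i (x i)%:R))^t* = diag_mx (\row_i (x i)%:R) :> 'M[R[i]]_n.+1.
  rewrite tr_diag_mx map_diag_mx; congr diag_mx; apply/rowP => i.
  by rewrite !mxE rmorph_nat.
apply/is_hermitianmxP; rewrite expr0 scale1r /compression -!mulmxE.
rewrite !trmx_mul !map_mxM /= /row_proj diagJ mulmxA; congr (_ *m _ *m _).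
rewrite /had_proj linearZ /= map_mxZ fmorphV rmorph_nat; congr (_ *: _).
rewrite !trmx_mul !map_mxM /= diagJ mulmxA.
by congr (_ *m _ *m _); apply/matrixP => i j; rewrite !mxE conjCK.
Qed.

(** The matrix is Hermitian, so the real part loses nothing, as [eigvalE] records. *)
Definition eigval c i : R := complex.Re (spectral_diag (compression c) 0 i).

Lemma eigvalE c i : spectral_diag (compression c) 0 i = (eigval c i)%:C.
Proof.
have /mxOverP/(_ 0 i) := hermitian_spectral_diag_real (compression_hermitian c).
by move=> /RRe_real.
Qed.

Lemma edf_compression c (z : R) :
  edf (compression c) z = \sum_i n.+1%:R^-1 * \1_`]-oo, z] (eigval c i).
Proof.
rewrite /edf -mulr_sumr mulrC -sum1_card natr_sum big_mkcond /=; congr (_ * _).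
apply: eq_bigr => i _; rewrite inE eigvalE indicE lecR.
by rewrite (_ : (_ \in _) = (eigval c i <= z)) ?mem_setE ?in_itv//=; case: (_ <= _).
Qed.

Context d (T : measurableType d) (P : probability T R).
Variables (al be : R) (X Y : {RV P >-> R}) (Xs Ys : nat -> {RV P >-> R}).
Hypotheses (al01 : 0 <= al <= 1) (be01 : 0 <= be <= 1)
  (hX1 : P [set w | X w = 1] = al%:E) (hX0 : P [set w | X w = 0] = (1 - al)%:E)
  (hY1 : P [set w | Y w = 1] = be%:E) (hY0 : P [set w | Y w = 0] = (1 - be)%:E)
  (hXY : indep_rv P X Y)
  (hiid : iid_copies P (fun w => (X w, Y w)) (fun i w => (Xs i w, Ys i w))).

Let wt (c : {ffun 'I_n.+1 -> bool} * {ffun 'I_n.+1 -> bool}) :=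
  bern_wt al c.1 * bern_wt be c.2.

Let wt_ge0 c : 0 <= wt c.
Proof.
have /andP[? ?] := al01; have /andP[? ?] := be01.
by rewrite mulr_ge0// prodr_ge0// => i _; rewrite /bern; case: ifP; rewrite ?subr_ge0.
Qed.

Let wt_sum : \sum_c wt c = 1.
Proof.
rewrite -(pair_bigA _ (fun x y => bern_wt al x * bern_wt be y)) /=.
under eq_bigr do rewrite -mulr_sumr bern_wt_sum mulr1.
exact: bern_wt_sum.
Qed.

(** The matrix is determined on each configuration event and these events have total mass 1, so
    measurability of the eigenvalue count in the sample does not have to be established. *)
Lemma expected_edf_mixture z :
  expected_edf P (fun w => XHYHX H (fun i => Xs i w) (fun i => Ys i w)) z =
  (\sum_c wt c * edf (compression c) z)%:E.
Proof.
rewrite /expected_edf.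
apply: (@expectation_finite_partition _ _ _ P _ (@config_event _ _ _ _ Xs Ys n.+1)
  (fun c => edf (compression c) z) wt
  (fun w => edf (XHYHX H (fun i => Xs i w) (fun i => Ys i w)) z)) => //.
- exact: config_event_measurable.
- exact: config_event_trivIset.
- exact: (config_event_prob hX1 hX0 hY1 hY0 hXY hiid).
- move=> w; rewrite /edf divr_ge0//= ler_pdivrMr ?ltr0n// mul1r ler_nat.
  by rewrite -[leqRHS]card_ord max_card.
- by move=> c w cw; rewrite (XHYHX_compression cw).
- by move=> c; rewrite /edf divr_ge0.
Qed.

(** The measure gives mass [wt c] / N to each eigenvalue of each [compression c]. By unitary
    diagonalization its moments are mean traces of powers. *)
Lemma spectral_mixture_exists : exists nu : probability (measurableTypeR R) R,
  [/\ has_df nu (expected_edf P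
        (fun w => XHYHX H (fun i => Xs i w) (fun i => Ys i w))),
      has_moments nu &
      forall k, (moment nu k)%:C = config_mean al%:C be%:C
        (fun x y => \tr (horner_mx (compression (x, y)) 'X^k)) / n.+1%:R].
Proof.
pose I := ({ffun 'I_n.+1 -> bool} * {ffun 'I_n.+1 -> bool} * 'I_n.+1)%type.
pose W (ci : I) := wt ci.1 * n.+1%:R^-1.
pose t (ci : I) := eigval ci.1 ci.2.
have n0 : n.+1%:R != 0 :> R by rewrite pnatr_eq0.
have W0 ci : 0 <= W ci by rewrite mulr_ge0.
have sumW (F : I -> R) : \sum_ci W ci * F ci =
    \sum_c wt c * \sum_i (n.+1%:R^-1 * F (c, i)).
  transitivity (\sum_(p : I) W (p.1, p.2) * F (p.1, p.2)).
    by apply: eq_bigr => -[].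
  rewrite -(pair_bigA _ (fun c i => W (c, i) * F (c, i))) /=.
  apply: eq_bigr => c _; rewrite mulr_sumr; apply: eq_bigr => i _.
  by rewrite mulrA.
have W1 : \sum_ci W ci = 1.
  rewrite -[RHS]wt_sum; under eq_bigr do rewrite -[W _]mulr1.
  rewrite (sumW (fun=> 1)); apply: eq_bigr => c _.
  by rewrite sumr_const card_ord mulr1 -[_ *+ _]mulr_natr mulVf// mulr1.
have [nu [nuA nug]] := finite_mixture_exists t W0 W1.
have mX k : measurable_fun setT (fun x : R => x ^+ k) by exact: exprn_measurable.
exists nu; split.
- move=> z; rewrite nuA// expected_edf_mixture; congr (_%:E).
  rewrite (sumW (fun ci => \1_`]-oo, z] (t ci))); apply: eq_bigr => c _.
  by rewrite edf_compression.
- by move=> k; have [] := nug _ (mX k).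
move=> k; have [_ nuE] := nug _ (mX k).
rewrite /moment /Rintegral nuE /= (sumW (fun ci => t ci ^+ k)).
rewrite /config_mean (pair_bigA _ (fun x y => _)) /= rmorph_sum mulr_suml /=.
apply: eq_bigr => -[x y] _ /=; rewrite rmorphM -[RHS](mulrA _ (\tr _)); congr (_ * _).
  rewrite /wt /bern_wt rmorphM !rmorph_prod /=; congr (_ * _); apply: eq_bigr => i _.
    by rewrite /bern; case: ifP => // _; rewrite rmorphB rmorph1.
  by rewrite /bern; case: ifP => // _; rewrite rmorphB rmorph1.
rewrite mxtrace_horner_normal ?hermitian_normalmx ?compression_hermitian//.
rewrite rmorph_sum mulr_suml; apply: eq_bigr => i _ /=.
by rewrite hornerXn eigvalE rmorphM /= fmorphV rmorph_nat rmorphXn mulrC.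
Qed.
End SpectralMixture.

(** * The limit law *)

Section TrigonometricIntegrals.
Context {R : realType}.
Notation mu := (@lebesgue_measure R).

Lemma is_derive_continuous (F : R -> R) (x a : R) :
  is_derive x (1 : R) F a -> {for x, continuous F}.
Proof. by move=> dF; apply/differentiable_continuous/derivable1_diffP. Qed.

Lemma derivable_continuous (F : R -> R) (x : R) :
  derivable F x 1 -> {for x, continuous F}.
Proof. by move=> dF; apply/differentiable_continuous/derivable1_diffP. Qed.

Lemma integral_is_derive (F f : R -> R) (a b : R) : a < b ->
  (forall x : R, is_derive x (1 : R) F (f x)) -> continuous f ->
  (\int[mu]_(x in `[a, b]) (f x)%:E = (F b - F a)%:E)%E.
Proof.
move=> ab dF cf; rewrite EFinB; apply: continuous_FTC2 => //.
- exact: continuous_subspaceT.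
- split.
  + by move=> x _; have [] := dF x.
  + exact/cvg_at_right_filter/(is_derive_continuous (dF _)).
  + exact/cvg_at_left_filter/(is_derive_continuous (dF _)).
- by move=> x _; rewrite derive1E; exact: derive_val.
Qed.

(** The identity U_n(cos th) sin th = sin((n + 1) th) for Chebyshev polynomials of the second kind,
    rescaled: for v = r^2/4, [cheb] at c + r cos th is (r/2)^n U_n(cos th). *)
Lemma cheb_trig (c r : R) n th :
  (cheb c (r ^+ 2 / 4) n).[c + r * cos th] * sin th =
  (r / 2) ^+ n * sin (n.+1%:R * th).
Proof.
suff [] : (cheb c (r ^+ 2 / 4) n).[c + r * cos th] * sin th =
    (r / 2) ^+ n * sin (n.+1%:R * th) /\
  (cheb c (r ^+ 2 / 4) n.+1).[c + r * cos th] * sin th =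
    (r / 2) ^+ n.+1 * sin (n.+2%:R * th) by [].
elim: n => [|n [IH1 IH2]]; split=> //.
- by rewrite /= -polyC1 hornerC expr0 !mul1r.
- rewrite /= !hornerE expr1 (_ : 2 * th = th + th); last by ring.
  by rewrite sinD; field.
- rewrite chebSS hornerD hornerN hornerM hornerZ hornerXsubC mulrBl -!(mulrA _ _ (sin th)) IH1 IH2.
  have e3 : sin (n.+3%:R * th) = sin (n.+2%:R * th) * cos th + cos (n.+2%:R * th) * sin th.
    by rewrite -sinD -[n.+3%:R]natr1 mulrDl mul1r.
  have e1 : sin (n.+1%:R * th) = sin (n.+2%:R * th) * cos th - cos (n.+2%:R * th) * sin th.
    by rewrite -sinB -[n.+2%:R]natr1 mulrDl mul1r addrK.
  rewrite e3 e1 !exprS.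
  by field.
Qed.

(** The product is half of cos(n th) - cos((n + 2) th), whose first term is constant exactly for n =
    0; that case has its own antiderivative. *)
Lemma integral_sin_sin n :
  (\int[mu]_(th in `[0%R, pi]) (sin th * sin (n.+1%:R * th))%:E
   = ((pi / 2) *+ (n == 0%N))%:E)%E.
Proof.
have cf : continuous (fun th : R => sin th * sin (n.+1%:R * th)).
  move=> x; apply: derivable_continuous; exact: ex_derive.
case: n => [|n] in cf *.
  have dF (x : R) : is_derive x (1 : R) (fun th => (th - sin th * cos th) / 2)
      (sin x * sin (1%:R * x)).
    apply: is_derive_eq; rewrite /GRing.scale /= mul1r.
    have := cos2Dsin2 x; nra.
  rewrite (integral_is_derive (pi_gt0 R) dF cf).
  by rewrite sinpi sin0 !mul0r !subr0 mul0r subr0.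
have dF (x : R) : is_derive x (1 : R) (fun th =>
    (sin (n.+1%:R * th) / n.+1%:R - sin (n.+3%:R * th) / n.+3%:R) / 2)
    (sin x * sin (n.+2%:R * x)).
  apply: is_derive_eq; rewrite /GRing.scale /= !mulr1.
  have -> : n.+1%:R * x = n.+2%:R * x - x by rewrite -[n.+2%:R]natr1 mulrDl mul1r addrK.
  have -> : n.+3%:R * x = n.+2%:R * x + x by rewrite -[n.+3%:R]natr1 mulrDl mul1r.
  rewrite cosB cosD; field.
  by rewrite nat1r -natrD !pnatr_eq0.
rewrite (integral_is_derive (pi_gt0 R) dF cf).
have sn k : sin (k%:R * pi) = 0 :> R.
  elim: k => [|k IH]; first by rewrite mul0r sin0.
  by rewrite -natr1 mulrDl mul1r sinDpi IH oppr0.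
by rewrite !sn !mulr0 sin0 !(mul0r, subrr, mulr0).
Qed.
End TrigonometricIntegrals.

(** * Integrals against the semicircle density *)

Section SemicircleIntegrals.
Context {R : realType}.
Notation mu := (@lebesgue_measure R).

(** With D^2 = d^2 - rho^2 the integrand is d - rho cos th - D^2 / (d + rho cos th), a trigonometric
    polynomial minus a Poisson kernel. *)
Lemma integral_poisson (d rho : R) : `|rho| < d ->
  (\int[mu]_(th in `[0%R, pi]) (rho ^+ 2 * sin th ^+ 2 / (d + rho * cos th))%:E
   = (pi * (d - Num.sqrt (d ^+ 2 - rho ^+ 2)))%:E)%E.
Proof.
move=> rd.
have d0 : 0 < d := le_lt_trans (normr_ge0 _) rd.
have dpos (th : R) : 0 < d + rho * cos th.
  have : `|rho * cos th| < d.
    by rewrite normrM (le_lt_trans _ rd)// ler_piMr// cos_max.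
  by rewrite ltr_norml => /andP[+ _]; rewrite -subr_gt0 opprK addrC.
have D2 : 0 < d ^+ 2 - rho ^+ 2.
  by rewrite subr_gt0 -(real_normK (num_real rho)) ltr_pXn2r ?nnegrE// ltW.
set D := Num.sqrt _.
have D0 : 0 < D by rewrite sqrtr_gt0.
have DE : D ^+ 2 = d ^+ 2 - rho ^+ 2 by rewrite sqr_sqrtr// ltW.
have cf : continuous (fun th : R => rho ^+ 2 * sin th ^+ 2 / (d + rho * cos th)).
  move=> x; apply: derivable_continuous.
  have dx0 : d + rho * cos x != 0 by rewrite gt_eqF.
  have dq : is_derive x (1 : R) (fun th => d + rho * cos th) (- (rho * sin x)).
    by apply: is_derive_eq; rewrite /GRing.scale /=; ring.
  have dV := @is_deriveV R (fun th => d + rho * cos th) x _ 1 dx0 dq.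
  exact: ex_derive.
(* With z = rho / (d + D) * e^(i th) the arctangent is the argument of 1 + z, so
   that D * th - 2 D * arg (1 + z) is an antiderivative of the Poisson kernel
   D^2 / (d + rho cos th), without the singularity at pi of the usual one. *)
pose F (th : R) := d * th - rho * sin th - D * th
  + 2 * D * atan (rho * sin th * (d + D + rho * cos th)^-1).
have dF (x : R) : is_derive x (1 : R) F (rho ^+ 2 * sin x ^+ 2 / (d + rho * cos x)).
  have q0 : d + D + rho * cos x != 0 by rewrite gt_eqF// addrAC addr_gt0.
  have dq : is_derive x (1 : R) (fun th => d + D + rho * cos th) (- (rho * sin x)).
    by apply: is_derive_eq; rewrite /GRing.scale /=; ring.
  have dV : is_derive x (1 : R) (fun th => (d + D + rho * cos th)^-1)
     (rho * sin x * (d + D + rho * cos x) ^- 2).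
    have := @is_deriveV R (fun th => d + D + rho * cos th) x _ 1 q0 dq.
    by rewrite /GRing.scale /= mulrNN mulrC.
  have du : is_derive x (1 : R) (fun th => rho * sin th * (d + D + rho * cos th)^-1)
     (rho * cos x * (d + D + rho * cos x)^-1
       + (rho * sin x) ^+ 2 * (d + D + rho * cos x) ^- 2).
    by apply: is_derive_eq; rewrite /GRing.scale /=; ring.
  have da := is_derive1_comp (is_derive1_atan _) du.
  have dx0 : d + rho * cos x != 0 by rewrite gt_eqF.
  have dD0 : d + D != 0 by rewrite gt_eqF// addr_gt0.
  apply: is_derive_eq; rewrite /GRing.scale /=.
  have hS : sin x ^+ 2 = 1 - cos x ^+ 2 := sin2cos2 x.
  (* The squared modulus of d + D + rho e^(ix) factors because rho^2 = (d - D)(d + D). *)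
  have E1 : 1 + (rho * sin x * (d + D + rho * cos x)^-1) ^+ 2 =
      2 * (d + D) * (d + rho * cos x) * (d + D + rho * cos x) ^- 2.
    apply: (mulIf (expf_neq0 2 q0)); rewrite mulfVK ?expf_neq0//.
    rewrite mulrDl mul1r exprMn exprVn mulfVK ?expf_neq0// exprMn hS.
    have -> : rho ^+ 2 = d ^+ 2 - D ^+ 2 by rewrite DE; ring.
    ring: DE.
  have E2 : rho * cos x * (d + D + rho * cos x)^-1
       + (rho * sin x) ^+ 2 * (d + D + rho * cos x) ^- 2 =
      (d + D) * (rho * cos x + d - D) * (d + D + rho * cos x) ^- 2.
    apply: (mulIf (expf_neq0 2 q0)); rewrite mulfVK ?expf_neq0//.
    rewrite mulrDl mulfVK ?expf_neq0// [X in _ / _ * X]expr2 mulrA mulfVK//.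
    rewrite exprMn hS.
    ring: DE.
  rewrite E1 E2.
  have -> : rho ^+ 2 * sin x ^+ 2 = d ^+ 2 - D ^+ 2 - rho ^+ 2 * cos x ^+ 2.
    rewrite hS DE; ring.
  field.
  by rewrite dx0 dD0 q0.
have cF := integral_is_derive (pi_gt0 R) dF cf.
rewrite cF /F sinpi sin0 !mulr0 !mul0r atan0 !mulr0 !subr0 !addr0 subr0.
by congr (_%:E); ring.
Qed.
End SemicircleIntegrals.

Section SemicircleLaw.
Context {R : realType}.
Notation mu := (@lebesgue_measure R).

(** Unnormalized, of total mass pi r^2 / 2; the root of a negative number is 0, so it vanishes off
    the support. *)
Definition semicircle (c r x : R) := Num.sqrt ((c + r - x) * (x - (c - r))).

Lemma semicircle_ge0 c r x : 0 <= semicircle c r x.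
Proof. exact: sqrtr_ge0. Qed.

Lemma continuous_semicircle c r : continuous (semicircle c r).
Proof.
move=> x; apply: continuous_comp; last exact: sqrt_continuous.
by apply: derivable_continuous; exact: ex_derive.
Qed.

(** The substitution x = c + r cos th is decreasing; one factor r sin th comes from the root and one
    from the derivative. *)
Lemma semicircle_substitution (c r : R) (g : R -> R) : 0 < r ->
  {within `[c - r, c + r], continuous g} ->
  (\int[mu]_(x in `[(c - r)%R, (c + r)%R]) (semicircle c r x * g x)%:E =
   \int[mu]_(th in `[0%R, pi]) (r ^+ 2 * sin th ^+ 2 * g (c + r * cos th)%R)%:E)%E.
Proof.
move=> r0 cg; pose F (th : R) := c + r * cos th.
have dF (x : R) : is_derive x (1 : R) F (- (r * sin x)).
  by apply: is_derive_eq; rewrite /GRing.scale /=; ring.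
have F'E : F^`()%classic = (fun th => - (r * sin th)).
  by apply/funext => x; rewrite derive1E; exact: derive_val.
have cF' : continuous (fun th : R => - (r * sin th)).
  by move=> x; apply: derivable_continuous; exact: ex_derive.
have F0 : F 0 = c + r by rewrite /F cos0 mulr1.
have Fpi : F pi = c - r by rewrite /F cospi mulrN1.
rewrite -F0 -Fpi (@integration_by_substitution_decreasing _ F (fun x => semicircle c r x * g x)).
- apply: eq_integral => th; rewrite inE /= in_itv /= => /andP[th0 thpi].
  congr (_%:E); rewrite F'E /= /semicircle /F !fctE.
  rewrite (_ : (_ - _) * _ = (r * sin th) ^+ 2); last first.
    by rewrite exprMn sin2cos2; ring.
  rewrite sqrtr_sqr ger0_norm; first by ring.
  by rewrite mulr_ge0 ?(ltW r0)// sin_ge0_pi// th0.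
- exact: pi_ge0.
- move=> x y xI yI xy; rewrite /F ltrD2l ltr_pM2l// ltr_cos//.
- by rewrite F'E => x _; exact: cF'.
- by rewrite F'E; apply/cvg_ex; eexists; apply/cvg_at_right_filter; exact: cF'.
- by rewrite F'E; apply/cvg_ex; eexists; apply/cvg_at_left_filter; exact: cF'.
- split.
  + by move=> x _; have [] := dF x.
  + exact/cvg_at_right_filter/(is_derive_continuous (dF _)).
  + exact/cvg_at_left_filter/(is_derive_continuous (dF _)).
- rewrite F0 Fpi => x; apply: (@continuousM _ (subspace `[c - r, c + r])) => //; last exact: cg.
  exact: (continuous_subspaceT (@continuous_semicircle c r)).
Qed.

(** Of the two sines produced by the substitution, one is absorbed by [cheb_trig], leaving the
    orthogonality of sines. For r = 0 the interval is a point. *)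
Lemma integral_semicircle_cheb (c r : R) n : 0 <= r ->
  (\int[mu]_(x in `[(c - r)%R, (c + r)%R])
     (semicircle c r x * (cheb c (r ^+ 2 / 4) n).[x])%:E =
   (r ^+ 2 * pi / 2 *+ (n == 0%N))%:E)%E.
Proof.
rewrite le_eqVlt => /predU1P[<-|r0].
  rewrite subr0 addr0 set_itv1 integral_set1.
  by rewrite expr0n/= !mul0r mul0rn.
rewrite semicircle_substitution//; last first.
  by apply: continuous_subspaceT; exact: continuous_horner.
transitivity (\int[mu]_(th in `[0%R, pi])
    ((r ^+ 2 * (r / 2) ^+ n)%:E * (sin th * sin (n.+1%:R * th))%:E))%E.
  apply: eq_integral => th _; rewrite -EFinM; congr (_%:E).
  have E := cheb_trig c r n th.
  rewrite (_ : _ * _.[_] = r ^+ 2 * sin th *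
    ((cheb c (r ^+ 2 / 4) n).[c + r * cos th] * sin th)); last by ring.
  by rewrite E; ring.
have iss : mu.-integrable `[0%R, pi] (EFin \o (fun th : R => sin th * sin (n.+1%:R * th))).
  apply: continuous_compact_integrable; first exact: segment_compact.
  apply: continuous_subspaceT => x.
  by apply: derivable_continuous; exact: ex_derive.
rewrite integralZl// integral_sin_sin -EFinM; congr (_%:E).
case: n {iss} => [|n]; first by rewrite expr0 !mulr1n mulr1 mulrA.
by rewrite !mulr0n mulr0.
Qed.

(** The pole is at c - s e, so s = 1 and s = -1 place it left and right of the support. The
    substitution gives [integral_poisson] with rho = s r. *)
Lemma integral_semicircle_pole_gt (c r e s : R) : 0 < r -> r < e -> `|s| = 1 ->
  (\int[mu]_(x in `[(c - r)%R, (c + r)%R])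
     (semicircle c r x / (e + s * (x - c)))%:E =
   (pi * (e - Num.sqrt (e ^+ 2 - r ^+ 2)))%:E)%E.
Proof.
move=> r0 re s1; have s2 : s ^+ 2 = 1 by rewrite -real_normK ?num_real// s1 expr1n.
have srE : `|s * r| = r by rewrite normrM s1 mul1r gtr0_norm.
rewrite (semicircle_substitution (g := fun x => (e + s * (x - c))^-1))//; last first.
  apply/continuous_in_subspaceT => x; rewrite inE/= in_itv/= => /andP[x1 x2].
  have x0 : e + s * (x - c) != 0.
    have : `|s * (x - c)| < e.
      by rewrite normrM s1 mul1r (le_lt_trans _ re)// ler_norml lerBlDl lerBrDl x1.
    by rewrite ltr_norml => /andP[+ _]; rewrite -subr_gt0 opprK addrC; exact: lt0r_neq0.
  apply: derivable_continuous.
  have dq : is_derive x (1 : R) (fun x => e + s * (x - c)) s.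
    by apply: is_derive_eq; rewrite /GRing.scale /=; ring.
  have dV := @is_deriveV R (fun x => e + s * (x - c)) x _ 1 x0 dq.
  exact: ex_derive.
have rho : `|s * r| < e by rewrite srE.
have := integral_poisson rho; rewrite exprMn s2 mul1r => <-.
apply: eq_integral => th _; congr (_%:E).
by rewrite addrAC subrr add0r mulrA.
Qed.
End SemicircleLaw.

Section SemicirclePole.
Context {R : realType}.
Notation mu := (@lebesgue_measure R).

(* When e = r the pole lies on the edge of the support; this case is reached by
   monotone convergence from e + 1 / (n + 1). *)
Lemma integral_semicircle_pole (c r e s : R) : 0 <= r -> r <= e -> `|s| = 1 ->
  (\int[mu]_(x in `[(c - r)%R, (c + r)%R])
     (semicircle c r x / (e + s * (x - c)))%:E =
   (pi * (e - Num.sqrt (e ^+ 2 - r ^+ 2)))%:E)%E.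
Proof.
move=> + re s1; rewrite le_eqVlt => /predU1P[r0|r0].
  rewrite -r0 subr0 addr0 set_itv1 integral_set1 expr0n subr0 sqrtr_sqr.
  by rewrite ger0_norm ?subrr ?mulr0// r0.
pose y (x : R) := e + s * (x - c).
pose g (n : nat) (x : R) : \bar R := (semicircle c r x / (e + n.+1%:R^-1 + s * (x - c)))%:E.
have y0 x : x \in `[c - r, c + r] -> 0 <= y x.
  rewrite in_itv/= => /andP[x1 x2].
  have : `|s * (x - c)| <= e.
    by rewrite normrM s1 mul1r (le_trans _ re)// ler_norml lerBlDl lerBrDl x1.
  by rewrite ler_norml => /andP[+ _]; rewrite -subr_ge0 opprK addrC.
(* A zero of the denominator has (x - c)^2 = e^2, at least r^2, so the numerator vanishes there and
   every term of the sequence is 0. *)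
have w0 x : x \in `[c - r, c + r] -> y x = 0 -> semicircle c r x = 0.
  move=> xI yx0; rewrite /semicircle ler0_sqrtr//.
  have -> : (c + r - x) * (x - (c - r)) = r ^+ 2 - e ^+ 2.
    have -> : e ^+ 2 = (x - c) ^+ 2.
      have -> : e = - (s * (x - c)) by apply/eqP; rewrite -addr_eq0 -/(y x) yx0.
      by rewrite sqrrN exprMn -[s ^+ 2]real_normK ?num_real// s1 expr1n mul1r.
    ring.
  by rewrite subr_le0 ler_pXn2r ?nnegrE ?(ltW r0)// (le_trans (ltW r0)).
have yn x n : x \in `[c - r, c + r] -> 0 < e + n.+1%:R^-1 + s * (x - c).
  by move=> /y0 yx; rewrite addrAC ltr_wpDl// invr_gt0.
have cvgI : (\int[mu]_(x in `[(c - r)%R, (c + r)%R]) g n x)%E @[n --> \oo] -->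
    (\int[mu]_(x in `[(c - r)%R, (c + r)%R]) (semicircle c r x / y x)%:E)%E.
  rewrite (_ : (\int[mu]_(x in _) (_ / y _)%:E)%E =
      (\int[mu]_(x in `[(c - r)%R, (c + r)%R]) limn (g ^~ x))%E); last first.
    apply: eq_integral => x; rewrite inE/= => xI; apply/esym/cvg_lim => //.
    have [yx0|yx0] := eqVneq (y x) 0.
      rewrite w0// mul0r (_ : g^~ x = fun=> 0%E); first exact: cvg_cst.
      by apply/funext => n; rewrite /g w0// mul0r.
    (* Pointwise convergence is continuity at 0 in the displacement z of the pole. *)
    pose h (z : R) := semicircle c r x / (e + z + s * (x - c)).
    have hc : {for 0, continuous h}.
      apply: derivable_continuous.
      have q0 : e + 0 + s * (x - c) != 0 by rewrite addr0.
      have dq : is_derive (0 : R) (1 : R) (fun z => e + z + s * (x - c)) 1.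
        by apply: is_derive_eq; rewrite /GRing.scale /=; ring.
      have dV := @is_deriveV R (fun z => e + z + s * (x - c)) 0 _ 1 q0 dq.
      exact: ex_derive.
    have hl : h n.+1%:R^-1 @[n --> \oo] --> h 0 by exact: cvg_comp cvg_harmonic hc.
    rewrite (_ : semicircle c r x / y x = h 0); last by rewrite /h addr0.
    exact: cvg_comp hl _.
  apply: cvg_monotone_convergence => //.
  - move=> n; apply/measurable_EFinP.
    apply: subspace_continuous_measurable_fun => //.
    apply/continuous_in_subspaceT => x; rewrite inE/= => xI.
    apply: (@continuousM _ R); first exact: continuous_semicircle.
    apply: derivable_continuous.
    have q0 : e + n.+1%:R^-1 + s * (x - c) != 0 by rewrite gt_eqF// yn.
    have dq : is_derive (x : R) (1 : R) (fun z => e + n.+1%:R^-1 + s * (z - c)) s.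
      by apply: is_derive_eq; rewrite /GRing.scale /=; ring.
    have dV := @is_deriveV R (fun z => e + n.+1%:R^-1 + s * (z - c)) x _ 1 q0 dq.
    exact: ex_derive.
  - move=> n x /= xI; rewrite /g lee_fin divr_ge0 ?semicircle_ge0//.
    by rewrite ltW// yn.
  - move=> x /= xI m n mn; rewrite /g lee_fin ler_wpM2l ?semicircle_ge0//.
    rewrite lef_pV2 ?posrE ?yn// lerD2r lerD2l lef_pV2 ?posrE ?ltr0n//.
    by rewrite ler_nat ltnS.
pose k (z : R) := pi * (z - Num.sqrt (z ^+ 2 - r ^+ 2)).
have kl : (k (e + n.+1%:R^-1))%:E @[n --> \oo] --> (k e)%:E.
  have kc : continuous k.
    move=> z; apply: (@continuousM R R (fun=> pi)
      (fun z => z - Num.sqrt (z ^+ 2 - r ^+ 2))); first exact: cvg_cst.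
    apply: (@continuousB R R R id (fun z => Num.sqrt (z ^+ 2 - r ^+ 2))).
      exact: cvg_id.
    apply: continuous_comp; last exact: sqrt_continuous.
    by apply: derivable_continuous; exact: ex_derive.
  have el : e + n.+1%:R^-1 @[n --> \oo] --> e.
    by rewrite -[X in _ --> X]addr0; apply: cvgD; [exact: cvg_cst|exact: cvg_harmonic].
  have hl := cvg_comp _ _ el (kc e).
  exact: cvg_comp hl _.
apply: (cvg_unique _ cvgI) => //.
rewrite (_ : (fun n => _) = (fun n => (k (e + n.+1%:R^-1))%:E))//.
apply/funext => n; rewrite /g integral_semicircle_pole_gt//.
by rewrite ltr_pwDr// invr_gt0.
Qed.
End SemicirclePole.

(** Inversion is expressed by a real power of the nonnegative number x^2; the formula also gives 0
    at x = 0. *)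
Lemma measurable_invr (R : realType) : measurable_fun setT (fun x : R => x^-1).
Proof.
have -> : (fun x : R => x^-1) = (fun x => x * (x ^+ 2) `^ (-1)).
  apply/funext => x; rewrite powR_inv1 ?sqr_ge0//.
  have [->|x0] := eqVneq x 0; first by rewrite invr0 mul0r.
  by field.
apply: measurable_funM => //.
apply: (measurableT_comp (f := fun y : R => y `^ (-1)) (g := fun x : R => x ^+ 2)).
  exact: measurable_powR.
exact: exprn_measurable.
Qed.

Lemma horner_bounded01 (R : realDomainType) (p : {poly R}) :
  exists C, forall x, 0 <= x <= 1 -> `|p.[x]| <= C.
Proof.
elim/poly_ind: p => [|p k [C pC]]; first by exists 0 => x _; rewrite horner0 normr0.
exists (C + `|k|) => x x01; rewrite !hornerE.
apply: le_trans (ler_normD _ _) _; rewrite lerD2r normrM.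
have /andP[x0 x1] := x01; rewrite (ger0_norm x0).
by rewrite -[leRHS]mulr1 ler_pM// pC.
Qed.

(** Defined for any sequence m, so that it applies to differences of moment sequences. *)
Definition moment_functional (R : pzRingType) (m : nat -> R) (p : seq R) :=
  \sum_(i < size p) p`_i * m i.

(** * Mass and moments of the limit distribution *)

Section LimitLaw.
Context {R : realType}.
Notation mu := (@lebesgue_measure R).
Variables (al be : R).
Hypotheses (al01 : 0 <= al <= 1) (be01 : 0 <= be <= 1).

Let c := al + be - 2 * al * be.
Let r := Num.sqrt (4 * al * be * (1 - al) * (1 - be)).
Let v := al * (1 - al) * (be * (1 - be)).
Let D := `[c - r, c + r]%classic.
Let f := limit_density al be.

Let r2 : r ^+ 2 = 4 * v.
Proof.
have /andP[a0 a1] := al01; have /andP[b0 b1] := be01.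
rewrite sqr_sqrtr; first by rewrite /v; ring.
by rewrite !mulr_ge0 ?subr_ge0.
Qed.

Let r0 : 0 <= r. Proof. exact: sqrtr_ge0. Qed.

(** At the poles 0 and 1 the radicand of [integral_semicircle_pole] is a perfect square; its root is
    the absolute value that later combines with the min and max of the atoms. Being nonnegative,
    these squares also place the support inside [0, 1]. *)
Let cr2 : c ^+ 2 - r ^+ 2 = (al - be) ^+ 2.
Proof. by rewrite r2 /c /v; ring. Qed.

Let Ccr2 : (1 - c) ^+ 2 - r ^+ 2 = (1 - al - be) ^+ 2.
Proof. by rewrite r2 /c /v; ring. Qed.

Let rc : r <= c.
Proof.
have /andP[a0 a1] := al01; have /andP[b0 b1] := be01.
have c0 : 0 <= c.
  have -> : c = al * (1 - be) + be * (1 - al) by rewrite /c; ring.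
  by rewrite addr_ge0// mulr_ge0// subr_ge0.
by rewrite -(ler_pXn2r (n := 2))// ?nnegrE// -subr_ge0 cr2 sqr_ge0.
Qed.

Let rC : r <= 1 - c.
Proof.
have /andP[a0 a1] := al01; have /andP[b0 b1] := be01.
have c0 : 0 <= 1 - c.
  have -> : 1 - c = al * be + (1 - be) * (1 - al) by rewrite /c; ring.
  by rewrite addr_ge0// mulr_ge0// subr_ge0.
by rewrite -(ler_pXn2r (n := 2))// ?nnegrE// -subr_ge0 Ccr2 sqr_ge0.
Qed.

Let D01 x : D x -> 0 <= x <= 1.
Proof.
rewrite /D /= in_itv /= => /andP[x1 x2].
have := rc; have := rC; lra.
Qed.

Let fE x : f x = semicircle c r x / (2 * pi * x * (1 - x)) * \1_D x.
Proof. by []. Qed.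

Let f_ge0 x : 0 <= f x.
Proof.
rewrite fE indicE; case: (boolP (x \in D)) => [|_]; last by rewrite mulr0.
rewrite inE => /D01/andP[x0 x1]; rewrite mulr1 divr_ge0 ?semicircle_ge0//.
by rewrite !mulr_ge0 ?pi_ge0// subr_ge0.
Qed.

Let mf : measurable_fun setT f.
Proof.
apply: measurable_funM; last by apply: measurable_indic; exact: measurable_itv.
apply: measurable_funM.
  exact: continuous_measurable_fun (@continuous_semicircle _ _ _).
apply: (measurableT_comp (f := fun y : R => y^-1) (g := fun x : R => 2 * pi * x * (1 - x))).
  exact: measurable_invr.
apply: measurable_funM; last exact: measurable_funB.
exact: measurable_funM.
Qed.

Let pole (e s x : R) := semicircle c r x / (e + s * (x - c)).

(** If 0 or 1 belongs to the support it is an edge. The convention 1/0 = 0 is then harmless in the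
    identities for f. *)
Let D_semicircle0 x : D x -> x = 0 \/ x = 1 -> semicircle c r x = 0.
Proof.
rewrite /D /= in_itv /= => /andP[x1 x2] x01; rewrite /semicircle ler0_sqrtr//.
by have := rc; have := rC; case: x01 x1 x2 => -> x1 x2 h1 h2; nra.
Qed.

(** Partial fractions 1/(x(1 - x)) = 1/x + 1/(1 - x), with both denominators centred at c. *)
Let f_split x : D x -> f x = (2 * pi)^-1 * (pole c 1 x + pole (1 - c) (-1) x).
Proof.
move=> Dx; rewrite fE indicE mem_set// mulr1 /pole.
have -> : c + 1 * (x - c) = x by ring.
have -> : 1 - c + -1 * (x - c) = 1 - x by ring.
have [x0|x0] := eqVneq x 0.
  by rewrite D_semicircle0 ?mul0r ?addr0 ?mulr0//; left.
have [x1|x1] := eqVneq x 1.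
  by rewrite D_semicircle0 ?mul0r ?addr0 ?mulr0//; right.
have x1' : 1 - x != 0 by rewrite subr_eq0 eq_sym.
rewrite -(mulrA (2 * pi)) invfM mulrCA; congr (_ * _).
by field; rewrite x0 x1'.
Qed.

Let D_cases x : D x -> [\/ x = 0, x = 1 | (x != 0) && (1 - x != 0)].
Proof.
move=> _; have [->|x0] := eqVneq x 0; first exact: Or31.
have [->|x1] := eqVneq x 1; first exact: Or32.
by apply: Or33; rewrite /= subr_eq0 eq_sym x1.
Qed.

Let fX x : D x -> x * f x = (2 * pi)^-1 * pole (1 - c) (-1) x.
Proof.
move=> Dx; rewrite f_split// /pole.
have -> : c + 1 * (x - c) = x by ring.
have -> : 1 - c + -1 * (x - c) = 1 - x by ring.
case: (D_cases Dx) => [x01|x01|/andP[x0 x1]].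
- by rewrite (D_semicircle0 Dx (or_introl x01)) !(mul0r, addr0, mulr0).
- by rewrite (D_semicircle0 Dx (or_intror x01)) !(mul0r, addr0, mulr0).
- by rewrite mulrCA; congr (_ * _); field; rewrite ?x0 ?x1.
Qed.

Let fXX2 x : D x -> (x - x ^+ 2) * f x = (2 * pi)^-1 * semicircle c r x.
Proof.
move=> Dx; rewrite f_split// /pole.
have -> : c + 1 * (x - c) = x by ring.
have -> : 1 - c + -1 * (x - c) = 1 - x by ring.
case: (D_cases Dx) => [x01|x01|/andP[x0 x1]].
- by rewrite D_semicircle0 ?mul0r ?addr0 ?mulr0//; left.
- by rewrite D_semicircle0 ?mul0r ?addr0 ?mulr0//; right.
- by rewrite mulrCA; congr (_ * _); field; rewrite ?x0 ?x1.
Qed.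

Let mpole e s : measurable_fun D (pole e s).
Proof.
apply: measurable_funTS; apply: measurable_funM.
  exact: continuous_measurable_fun (@continuous_semicircle _ _ _).
apply: (measurableT_comp (f := fun y : R => y^-1) (g := fun x : R => e + s * (x - c))).
  exact: measurable_invr.
apply: measurable_funD => //; apply: measurable_funM => //.
exact: measurable_funB.
Qed.

Let pole_ge0 e s x : r <= e -> `|s| = 1 -> D x -> 0 <= pole e s x.
Proof.
rewrite /D /= in_itv /= => re s1 /andP[x1 x2].
rewrite divr_ge0 ?semicircle_ge0//.
have : `|s * (x - c)| <= e.
  by rewrite normrM s1 mul1r (le_trans _ re)// ler_norml lerBlDl lerBrDl x1.
by rewrite ler_norml => /andP[+ _]; rewrite -subr_ge0 opprK addrC.
Qed.

Let normN1 : `|(-1 : R)| = 1. Proof. by rewrite normrN1. Qed.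

Let integral_pole0 :
  (\int[mu]_(x in D) (pole c 1 x)%:E = (pi * (c - `|al - be|))%:E)%E.
Proof.
by rewrite (integral_semicircle_pole _ r0 rc (normr1 _)) cr2 sqrtr_sqr.
Qed.

Let integral_pole1 :
  (\int[mu]_(x in D) (pole (1 - c) (-1) x)%:E = (pi * (1 - c - `|1 - al - be|))%:E)%E.
Proof.
by rewrite (integral_semicircle_pole _ r0 rC normN1) Ccr2 sqrtr_sqr.
Qed.

Let integral_restrict (h : R -> R) :
  (\int[mu]_x (h x * f x)%:E = \int[mu]_(x in D) (h x * f x)%:E)%E.
Proof.
rewrite [RHS]integral_mkcond; apply: eq_integral => x _; rewrite patchE.
by case: ifPn => // xD; rewrite fE indicE (negbTE xD) !mulr0.
Qed.

Let pi2 : (2 * pi)^-1 * pi = 2^-1 :> R.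
Proof. by rewrite invfM -mulrA mulVf ?mulr1// gt_eqF// pi_gt0. Qed.

Let integral_f : (\int[mu]_x (f x)%:E = ((1 - `|al - be| - `|1 - al - be|) / 2)%:E)%E.
Proof.
transitivity (\int[mu]_x (1 * f x)%:E)%E.
  by apply: eq_integral => x _; rewrite mul1r.
rewrite (integral_restrict (fun=> 1)).
transitivity (\int[mu]_(x in D)
    ((2 * pi)^-1%:E * ((pole c 1 x)%:E + (pole (1 - c) (-1) x)%:E)))%E.
  by apply: eq_integral => x; rewrite inE => Dx; rewrite mul1r f_split// EFinM EFinD.
have mD : measurable D by exact: measurable_itv.
have p0 x : D x -> (0 <= (pole c 1 x)%:E)%E.
  by move=> Dx; rewrite lee_fin pole_ge0// normr1.
have p1 x : D x -> (0 <= (pole (1 - c) (-1) x)%:E)%E.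
  by move=> Dx; rewrite lee_fin pole_ge0.
have m0 : measurable_fun D (EFin \o pole c 1) by exact/measurable_EFinP.
have m1 : measurable_fun D (EFin \o pole (1 - c) (-1)) by exact/measurable_EFinP.
rewrite ge0_integralZl//; last 3 first.
- exact: emeasurable_funD.
- by move=> x Dx; rewrite adde_ge0 ?p0 ?p1.
- by rewrite lee_fin invr_ge0 mulr_ge0 ?pi_ge0.
rewrite ge0_integralD// integral_pole0 integral_pole1 -EFinD -EFinM.
by congr (_%:E); rewrite -mulrDr mulrA pi2; field.
Qed.

Let integral_fX : (\int[mu]_x (x * f x)%:E = ((1 - c - `|1 - al - be|) / 2)%:E)%E.
Proof.
rewrite (integral_restrict id).
transitivity (\int[mu]_(x in D) ((2 * pi)^-1%:E * (pole (1 - c) (-1) x)%:E))%E.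
  by apply: eq_integral => x; rewrite inE => Dx; rewrite fX// EFinM.
rewrite ge0_integralZl//; last 4 first.
- exact: measurable_itv.
- by apply/measurable_EFinP; exact: mpole.
- by move=> x Dx; rewrite lee_fin pole_ge0.
- by rewrite lee_fin invr_ge0 mulr_ge0 ?pi_ge0.
rewrite integral_pole1 -EFinM.
by congr (_%:E); rewrite mulrA pi2; field.
Qed.

(** The factor x - x^2 cancels the denominator of f and leaves the semicircle orthogonality
    relation. *)
Let integral_fcheb n :
  (\int[mu]_x ((('X - 'X^2) * cheb c v n).[x] * f x)%:E = (v *+ (n == 0%N))%:E)%E.
Proof.
rewrite (integral_restrict (fun x => (('X - 'X^2) * cheb c v n).[x])).
transitivity (\int[mu]_(x in D) ((2 * pi)^-1%:E *
    (semicircle c r x * (cheb c (r ^+ 2 / 4) n).[x])%:E))%E.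
  apply: eq_integral => x; rewrite inE => Dx; rewrite -EFinM; congr (_%:E).
  rewrite r2 (mulrC 4) mulfK ?pnatr_eq0//.
  rewrite hornerM hornerD hornerN hornerX hornerXn mulrAC fXX2//; ring.
rewrite integralZl//.
- rewrite integral_semicircle_cheb// -EFinM; congr (_%:E).
  case: n => [|n]; last by rewrite !mulr0n mulr0.
  rewrite !mulr1n (_ : _ * _ = (2 * pi)^-1 * pi * (r ^+ 2 / 2)); last by ring.
  by rewrite pi2 r2; field.
- exact: measurable_itv.
- apply: continuous_compact_integrable; first exact: segment_compact.
  apply: continuous_subspaceT => x; apply: (@continuousM _ R).
    exact: continuous_semicircle.
  exact: continuous_horner.
Qed.

Let integrable_f : mu.-integrable setT (EFin \o f).
Proof.
apply/integrableP; split; first exact/measurable_EFinP.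
under eq_integral do rewrite /= ger0_norm//.
by rewrite /= integral_f ltry.
Qed.

Let integrable_horner (p : {poly R}) :
  mu.-integrable setT (EFin \o (fun x => p.[x] * f x)).
Proof.
have [C pC] := horner_bounded01 p.
have mp : measurable_fun setT (fun x : R => p.[x]).
  exact: continuous_measurable_fun (@continuous_horner _ _).
apply: (@le_integrable _ _ _ mu setT measurableT _ (fun x => C%:E * (f x)%:E)%E).
- by apply/measurable_EFinP; exact: measurable_funM.
- move=> x _ /=; rewrite lee_fin (normrM p.[x]) (normrM C) (ger0_norm (f_ge0 x)).
  have [xD|xD] := boolP (x \in D).
    rewrite ler_wpM2r ?f_ge0//; apply: le_trans (ler_norm C).
    by apply: pC; apply: D01; rewrite inE in xD.
  by rewrite fE indicE (negbTE xD) !mulr0.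
- exact: integrableZl.
Qed.

Lemma limit_law_exists : exists nu : probability (measurableTypeR R) R,
  [/\ has_density01 nu (1 - Num.min al be) (Num.max (al + be - 1) 0)
        (limit_density al be),
      has_moments nu, moment nu 1 = al * be &
      forall n, moment_functional (moment nu) (('X - 'X^2) * cheb c v n) =
        v *+ (n == 0%N)].
Proof.
have /andP[a0 a1] := al01; have /andP[b0 b1] := be01.
pose w i := if i is 0%N then 1 - Num.min al be else Num.max (al + be - 1) 0.
pose t i : R := if i is 0%N then 0 else 1.
have w0 i : 0 <= w i.
  case: i => [|i]; last by rewrite /w le_max lexx orbT.
  by rewrite /w subr_ge0 ge_min a1.
(* Once min and max are written with absolute values, these cancel against those in [integral_f]. *)
have mass : (\sum_(i < 2) (w i)%:E + \int[mu]_x (f x)%:E = 1)%E.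
  rewrite integral_f !big_ord_recl big_ord0 adde0 -!EFinD; congr (_%:E).
  rewrite /w /= minr_absE maxr_absE subr0.
  rewrite (_ : al + be - 1 = - (1 - al - be)) ?normrN; last by ring.
  by field.
have [nu [nuA nug]] := mixture_exists t w0 f_ge0 mf mass.
have mh (p : {poly R}) : measurable_fun setT (fun x : R => p.[x]).
  exact: continuous_measurable_fun (@continuous_horner _ _).
have nuI (p : {poly R}) : nu.-integrable setT (EFin \o (fun x : R => p.[x])).
  by have [] := nug _ (mh p) (integrable_horner p).
have nuE (p : {poly R}) : (\int[nu]_x (p.[x])%:E =
    (w 0 * p.[0] + w 1 * p.[1])%:E + \int[mu]_x (p.[x] * f x)%:E)%E.
  have [_ ->] := nug _ (mh p) (integrable_horner p).
  by rewrite !big_ord_recl big_ord0 addr0.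
have mom : has_moments nu.
  by move=> k; have := nuI 'X^k; under eq_fun do rewrite hornerXn.
have momE k : moment nu k = fine (\int[nu]_x (('X^k).[x])%:E).
  by congr fine; apply: eq_integral => x _; rewrite hornerXn.
exists nu; split => //.
- by move=> A mA; rewrite nuA// !big_ord_recl big_ord0 adde0.
- rewrite momE nuE !hornerXn expr0n /= mulr0 add0r expr1n mulr1.
  under eq_integral do rewrite hornerXn.
  rewrite integral_fX -EFinD /= /w /= maxr_absE subr0 /c.
  rewrite (_ : al + be - 1 = - (1 - al - be)) ?normrN; last by ring.
  by field.
- move=> n; set p := _ * _.
  have -> : moment_functional (moment nu) p = fine (\int[nu]_x (p.[x])%:E).
    transitivity (fine (\int[nu]_x (\sum_(i < size p) ((p`_i)%:E * (x ^+ i)%:E))%E)); last first.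
      congr fine; apply: eq_integral => x _.
      by rewrite horner_coef -sumEFin; apply: eq_bigr => i _; rewrite EFinM.
    rewrite integral_sum//=; last by move=> i; apply: integrableZl => //; exact: mom.
    rewrite (eq_bigr (fun i : 'I_(size p) => (p`_i * moment nu i)%:E)).
      by rewrite sumEFin.
    move=> i _; rewrite integralZl//.
    rewrite EFinM /moment /Rintegral fineK//.
    exact: integrable_fin_num (mom i).
  (* The atoms sit at the zeros of x - x^2 and contribute nothing. *)
  rewrite nuE integral_fcheb /p !hornerM !hornerD !hornerN !hornerX !hornerXn.
  by rewrite expr0n expr1n !subrr !mul0r !mulr0 addr0 -EFinD /= add0r.
Qed.
End LimitLaw.

(** * Convergence of the moments *)

Lemma cheb_monic (R : comNzRingType) (c v : R) m :
  cheb c v m \is monic /\ size (cheb c v m) = m.+1.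
Proof.
suff [] : (cheb c v m \is monic /\ size (cheb c v m) = m.+1) /\
    (cheb c v m.+1 \is monic /\ size (cheb c v m.+1) = m.+2) by [].
elim: m => [|m [[M0 S0] [M1 S1]]]; split=> //.
- by rewrite /= monic1 size_poly1.
- by rewrite /= monicXsubC size_XsubC.
- have S2 : size (('X - c%:P) * cheb c v m.+1) = m.+3.
    by rewrite size_monicM ?monicXsubC ?monic_neq0// size_XsubC S1.
  have lt : (size (- (v *: cheb c v m))%R < size (('X - c%:P) * cheb c v m.+1)%R)%N.
    by rewrite size_polyN S2 ltnS (leq_trans (size_scale_leq _ _))// S0.
  rewrite chebSS; split; last by rewrite size_polyDl.
  by rewrite monicE lead_coefDl// -monicE monicMl ?monicXsubC.
Qed.

(** The top coefficient -1 is a unit, so the moment of degree m + 2 can be solved for from those of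
    lower degree. *)
Lemma edge_cheb_coef (R : comNzRingType) (c v : R) m :
  (size (('X - 'X^2) * cheb c v m)%R <= m.+3)%N /\
  (('X - 'X^2) * cheb c v m)`_m.+2 = -1.
Proof.
have [M S] := cheb_monic c v m.
split.
  apply: leq_trans (size_polyMleq _ _) _; rewrite S addnS /=.
  suff : (size ('X - 'X^2 : {poly R})%R <= 3)%N by move=> h; rewrite -[m.+3]/(3 + m)%N leq_add2r.
  apply: leq_trans (size_polyD _ _) _.
  by rewrite size_polyN size_polyXn size_polyX.
rewrite mulrBl coefB coefXM /= coefXnM /= !subn2 /=.
have -> : (cheb c v m)`_m = 1 by move: M; rewrite monicE lead_coefE S => /eqP.
by rewrite (nth_default 0) ?S// sub0r.
Qed.

Lemma moment_functional_widen (R : pzRingType) (m : nat -> R) (p : seq R) k :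
  (size p <= k)%N -> moment_functional m p = \sum_(i < k) p`_i * m i.
Proof.
move=> pk; rewrite /moment_functional (big_ord_widen k (fun i => p`_i * m i))//.
rewrite big_mkcond; apply: eq_bigr => i _; case: ltnP => // h.
by rewrite nth_default ?mul0r.
Qed.

Lemma vanishing_sum (C : numFieldType) k (F : 'I_k -> nat -> C) :
  (forall i, vanishing (F i)) -> vanishing (fun n => \sum_i F i n).
Proof.
elim: k F => [|k IH] F vF.
  by apply: vanishing_ext (vanishing0 _) => n; rewrite big_ord0.
apply: vanishing_ext (vanishingD (vF ord0) (IH (fun i => F (lift ord0 i)) _)) => // n.
by rewrite big_ord_recl.
Qed.

(* The polynomials 1, X and (X - X^2) P_m have distinct degrees 0, 1, m + 2 and
   hence span all polynomials. *)
Lemma vanishing_moments (R : numFieldType) (delta : nat -> nat -> R) (c v : R) :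
  vanishing (delta^~ 0%N) -> vanishing (delta^~ 1%N) ->
  (forall m, vanishing (fun n => moment_functional (delta n)
     (('X - 'X^2) * cheb c v m))) ->
  forall k, vanishing (delta^~ k).
Proof.
move=> v0 v1 vS k; elim/ltn_ind: k => -[//|[//|m]] IH.
pose q := ('X - 'X^2) * cheb c v m.
have [sq qm] : (size q <= m.+3)%N /\ q`_m.+2 = -1 := edge_cheb_coef c v m.
have vsum : vanishing (fun n => \sum_(i < m.+2) q`_i * delta n i).
  apply: (vanishing_sum (F := fun (i : 'I_m.+2) n => q`_i * delta n i)) => i.
  by apply: vanishingZ; exact: IH.
(* The moment of degree m + 2 is the lower part minus the functional. *)
apply: vanishing_ext (vanishingD vsum (vanishingZ (-1) (vS m))) => n.
rewrite (moment_functional_widen _ sq) [\sum_(i < m.+3) _]big_ord_recr /= qm.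
rewrite !mulN1r opprD opprK addrA subrr; exact: add0r.
Qed.

Section MeanSpectralLinear.
Variables (C : numClosedFieldType) (H : forall n, 'M[C]_n.+1) (al be : C).

Lemma mean_spectral_coef n (f : {poly C}) :
  mean_spectral H al be n f =
  moment_functional (fun k => mean_spectral H al be n 'X^k) f.
Proof.
rewrite /moment_functional /mean_spectral /trace_state.
under eq_bigr do rewrite mulrA -config_meanZ.
rewrite -mulr_suml; congr (_ / _).
have cm_sum k (F : 'I_k -> _) : \sum_i config_mean (n := n) al be (F i) =
    config_mean al be (fun x y => \sum_i F i x y).
  elim: k F => [|k IH] F.
    rewrite big_ord0 (config_mean_ext al be (G := fun _ _ => 0)) ?config_mean_cst// => x y.
    by rewrite big_ord0.
  rewrite big_ord_recl IH -config_meanD; apply: config_mean_ext => x y.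
  by rewrite big_ord_recl.
rewrite cm_sum; apply: config_mean_ext => x y.
rewrite -{1}[f]coefK poly_def !raddf_sum /=; apply: eq_bigr => i _.
by rewrite linearZ /= mxtraceZ.
Qed.
End MeanSpectralLinear.

Section RealVanishing.
Variable R : realType.

(** An inequality in R[i] implies that of the real parts, so the real part of the constant bounds
    the real sequence. *)
Lemma vanishing_complex (F : nat -> R) :
  vanishing (fun n => (F n)%:C) -> vanishing F.
Proof.
move=> [k Fk]; exists (complex.Re k) => n.
have := Fk n; rewrite normc_def /= expr0n /= addr0 sqrtr_sqr => h.
have -> : complex.Re k / n.+1%:R = complex.Re (k / n.+1%:R).
  rewrite -(rmorph_nat (real_complex R)) -fmorphV.
  by case: k {Fk h} => x y /=; rewrite mulr0 subr0.
by move: h; rewrite lecE => /andP[_].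
Qed.

Lemma vanishing_cvg (F : nat -> R) (l : R) :
  vanishing (fun n => F n - l) -> F n @[n --> \oo] --> l.
Proof.
move=> [k Fk].
have kh : k * n.+1%:R^-1 @[n --> \oo] --> (0 : R).
  by rewrite -[X in _ --> X](mulr0 k); apply: cvgM; [exact: cvg_cst|exact: cvg_harmonic].
apply/cvgrPdist_le => e e0; near=> n.
rewrite distrC (le_trans (Fk n))// (le_trans (ler_norm _))//.
rewrite -normrN -sub0r.
by near: n; move: e e0; apply/cvgrPdist_le.
Unshelve. all: by end_near. Qed.

Lemma moment0 (mu : probability (measurableTypeR R) R) : moment mu 0 = 1.
Proof.
transitivity (fine (1%:E * mu setT)%E); last by rewrite probability_setT mule1.
by rewrite /moment /Rintegral; under eq_integral do rewrite expr0; rewrite integral_cst.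
Qed.

Lemma map_cheb (c v : R) m :
  map_poly (real_complex R) (cheb c v m) = cheb c%:C v%:C m.
Proof.
suff [] : map_poly (real_complex R) (cheb c v m) = cheb c%:C v%:C m /\
  map_poly (real_complex R) (cheb c v m.+1) = cheb c%:C v%:C m.+1 by [].
elim: m => [|m [IH1 IH2]]; split=> //.
- by rewrite rmorph1.
- by rewrite /= rmorphB /= map_polyX map_polyC.
- rewrite !chebSS rmorphB rmorphM rmorphB /= map_polyX map_polyC /= IH2.
  by rewrite map_polyZ IH1.
Qed.
End RealVanishing.

Theorem corollary3p9 (R : realType) (alpha beta : R)
    (halpha : 0 <= alpha <= 1) (hbeta : 0 <= beta <= 1)
    (H : forall N : nat, 'M[R[i]]_N)
    (hH : forall N : nat, (0 < N)%N -> complex_hadamard (H N))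
    (d : measure_display) (T : measurableType d) (P : probability T R)
    (X Y : {RV P >-> R})
    (hX1 : P [set w | X w = 1] = alpha%:E)
    (hX0 : P [set w | X w = 0] = (1 - alpha)%:E)
    (hY1 : P [set w | Y w = 1] = beta%:E)
    (hY0 : P [set w | Y w = 0] = (1 - beta)%:E)
    (hXY : indep_rv P X Y)
    (Xs Ys : nat -> {RV P >-> R})
    (hiid : iid_copies P (fun w => (X w, Y w)) (fun i w => (Xs i w, Ys i w))) :
  exists (nu : nat -> probability (measurableTypeR R) R)
         (mu : probability (measurableTypeR R) R),
    [/\ (* nu n is the distribution given by the expected empirical
           distribution function in dimension N = n + 1 *)
        forall n : nat, has_df (nu n)
          (expected_edf P
            (fun w => XHYHX (H n.+1) (fun i => Xs i w) (fun i => Ys i w))),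
        has_density01 mu (1 - Num.min alpha beta)
          (Num.max (alpha + beta - 1) 0) (limit_density alpha beta) &
        cvg_in_moments nu mu].
Proof.
have Hflat n : forall i j, `|H n.+1 i j| = 1.
  by have [] := complex_hadamardP (hH _ (ltn0Sn n)).
have HHt n : H n.+1 *m (H n.+1)^t* = n.+1%:R%:M.
  by have [] := complex_hadamardP (hH _ (ltn0Sn n)).
pose H' n := H n.+1.
have [nu nuP] := choice (fun n => spectral_mixture_exists (H n.+1)
  halpha hbeta hX1 hX0 hY1 hY0 hXY hiid).
have [mu [mud mum mu1 mucheb]] := limit_law_exists halpha hbeta.
exists nu, mu; split => //; first by move=> n; have [] := nuP n.
split => // [n|]; first by have [] := nuP n.
have nuE n k : (moment (nu n) k)%:C = mean_spectral H' alpha%:C beta%:C n 'X^k.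
  by have [_ _ ->] := nuP n.
have a01 : 0 <= alpha%:C <= 1.
  by rewrite !lecE /= !eqxx.
have b01 : 0 <= beta%:C <= 1.
  by rewrite !lecE /= !eqxx.
move=> k; apply: vanishing_cvg.
pose c := alpha + beta - 2 * alpha * beta.
pose v := alpha * (1 - alpha) * (beta * (1 - beta)).
(* The three families are settled in turn: both masses are 1, the first moments tend to alpha beta,
   and the Chebyshev relations hold exactly for the limit and up to O(1/N) for [nu n]. *)
apply: (vanishing_moments (delta := fun n k => moment (nu n) k - moment mu k)
  (c := c) (v := v)) => [||m].
- by apply: vanishing_ext (vanishing0 _) => n; rewrite !moment0 subrr.
- apply: vanishing_complex.
  apply: vanishing_ext (mean_spectralX (H := H') Hflat HHt a01 b01) => n.
  by rewrite mu1 rmorphB rmorphM /= nuE.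
- apply: vanishing_complex.
  apply: vanishing_ext (mean_spectral_cheb (H := H') Hflat HHt a01 b01 m) => n.
  set q := ('X - 'X^2) * cheb c v m.
  have -> : moment_functional (fun k => moment (nu n) k - moment mu k) q =
      moment_functional (moment (nu n)) q - moment_functional (moment mu) q.
    by rewrite /moment_functional -sumrB; apply: eq_bigr => i _; rewrite mulrBr.
  rewrite mucheb rmorphB /= rmorphMn /= -[X in _ = _ - X]mulr_natr; congr (_ - _ * _).
    rewrite mean_spectral_coef.
    have -> : ('X - 'X^2) * cheb (alpha%:C + beta%:C - 2 * alpha%:C * beta%:C)
        (alpha%:C * (1 - alpha%:C) * (beta%:C * (1 - beta%:C))) m =
        map_poly (real_complex R) q.
      rewrite rmorphM rmorphB /= map_polyX map_polyXn map_cheb /c /v.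
      by rewrite !(rmorphB, rmorphD, rmorphM, rmorph1, rmorph_nat).
    rewrite /moment_functional rmorph_sum size_map_poly; apply: eq_bigr => i _ /=.
    by rewrite coef_map rmorphM /= nuE.
  by rewrite /v !(rmorphB, rmorphM, rmorph1).
Qed.
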